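(* Let $0<p\le q<\infty$ and $0<\alpha<\infty$ be such that $p\alpha>1$. Let $\omega\in\mathcal{I}\cup\mathcal{R}$, and let $\mu$ be a positive Borel measure on $\mathbb{D}$. Then the operator $\varphi\mapsto[M_\omega(|\varphi|^{1/\alpha})]^{\alpha}$ is bounded from $L^p_\omega$ to $L^q(\mu)$ if and only if $$\sup_{I\subset\mathbb{T}}\frac{\mu(S(I))}{\left(\omega(S(I))\right)^{q/p}}<\infty .$$ Moreover, $$\left\|[M_\omega((\cdot)^{1/\alpha})]^{\alpha}\right\|^q_{(L^p_\omega,L^q(\mu))}\asymp\sup_{I\subset\mathbb{T}}\frac{\mu(S(I))}{\left(\omega(S(I))\right)^{q/p}} .$$
   Context: $\mathbb{D}$ is the open unit disc of $\mathbb{C}$, $\mathbb{T}$ its boundary, and $dA=\frac{dx\,dy}{\pi}$. A weight is a function $\omega:\mathbb{D}\to(0,\infty)$ integrable over $\mathbb{D}$; it is radial if $\omega(z)=\omega(|z|)$. For a radial weight put $\psi_\omega(r)=\frac{1}{\omega(r)}\int_r^1\omega(s)\,ds$, $0\le r<1$. $\mathcal{R}$ is the class of continuous radial weights for which there is $C\ge1$ with $C^{-1}(1-r)\le\psi_\omega(r)\le C(1-r)$ for all $0\le r<1$. $\mathcal{I}$ is the class of continuous radial weights with $\lim_{r\to1^-}\frac{\psi_\omega(r)}{1-r}=\infty$. $L^p_\omega$ is the space of measurable functions $\varphi$ on $\mathbb{D}$ with $\|\varphi\|_{L^p_\omega}^p=\int_{\mathbb{D}}|\varphi|^p\omega\,dA<\infty$.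 For an interval (arc) $I\subset\mathbb{T}$ of Lebesgue measure $|I|$, the Carleson square is $S(I)=\{re^{it}\in\mathbb{D}: e^{it}\in I,\ 1-|I|\le r<1\}$, and $\omega(E)=\int_E\omega\,dA$ for measurable $E\subset\mathbb{D}$. For $\varphi\in L^1_\omega$, the weighted maximal function is $$M_\omega(\varphi)(z)=\sup_{I:\,z\in S(I)}\frac{1}{\omega(S(I))}\int_{S(I)}|\varphi(\xi)|\omega(\xi)\,dA(\xi),\quad z\in\mathbb{D},$$ the supremum being over intervals $I\subset\mathbb{T}$. The operator is bounded if there is $C$ with $\|[M_\omega(|\varphi|^{1/\alpha})]^\alpha\|_{L^q(\mu)}\le C\|\varphi\|_{L^p_\omega}$ for all $\varphi\in L^p_\omega$, and $\|\cdot\|_{(L^p_\omega,L^q(\mu))}$ is the least such $C$. The notation $a\asymp b$ means two-sided comparability up to positive constants depending only on $p,q,\alpha,\omega$. *)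

(* Defs.v *)
From HB Require Import structures.
From mathcomp Require Import all_boot all_order all_algebra.
From mathcomp Require Import all_classical all_reals all_analysis.

Set Implicit Arguments.
Unset Strict Implicit.
Unset Printing Implicit Defensive.

Import Order.TTheory GRing.Theory Num.Theory.
Import numFieldNormedType.Exports.

Local Open Scope classical_set_scope.
Local Open Scope ring_scope.

(* Complex numbers are pairs of reals, (x, y) standing for x + iy, so that the
   library's product sigma-algebra (Borel), product topology and product measure
   apply. The library norm on pairs is the sup norm, hence the separate modulus
   [cmod]. Functions on the disc are total functions that are only ever
   inspected at points of the disc. *)

(* [measurableTypeR R] is R with the Borel sigma-algebra carrying
   [lebesgue_measure]. *)
Notation cplane R := (measurableTypeR R * measurableTypeR R)%type.

Section Plane.
Context {R : realType}.
Local Notation C := (cplane R).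

Definition cmod (z : C) : R := Num.sqrt ((z.1 : R) ^+ 2 + (z.2 : R) ^+ 2).

Definition RtoC (x : R) : C := (x, 0).

(* r e^{it} *)
Definition cpolar (r t : R) : C := (r * cos t, r * sin t).

Definition disc : set C := [set z | cmod z < 1].

Lemma pi_inv_ge0 : 0 <= (pi : R)^-1.
Proof. by rewrite invr_ge0 pi_ge0. Qed.

(* dA = dx dy / pi *)
Definition areaA : {measure set C -> \bar R} :=
  mscale (NngNum pi_inv_ge0)
    (lebesgue_measure \x lebesgue_measure)%E.

End Plane.

Section Weights.
Context {R : realType}.
Local Notation C := (cplane R).
Implicit Types (w : C -> R) (E : set C) (r : R).

Definition weight w : Prop :=
  (forall z, disc z -> 0 < w z) /\ areaA.-integrable disc (EFin \o w).

Definition radial w : Prop := forall z, disc z -> w z = w (RtoC (cmod z)).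

Definition continuous_radial_weight w : Prop :=
  [/\ weight w, radial w & {within (disc : set (R * R)), continuous (w : R * R -> R)}].

(* w(E); meaningful for E a measurable subset of the disc *)
Definition wmeas w E : \bar R := (\int[areaA]_(z in E) (w z)%:E)%E.

Definition psi w r : \bar R :=
  ((w (RtoC r))^-1%:E *
   \int[lebesgue_measure]_(s in `[r, 1%R[) (w (RtoC s))%:E)%E.

Definition class_R w : Prop :=
  continuous_radial_weight w /\
  exists K : R, 1 <= K /\
    forall r, 0 <= r < 1 ->
      ((K^-1 * (1 - r))%:E <= psi w r <= (K * (1 - r))%:E)%E.

Definition class_I w : Prop :=
  continuous_radial_weight w /\
  (psi w r * ((1 - r)^-1)%:E)%E @[r --> 1^'-] --> +oo%E.

End Weights.

Section Carleson.
Context {R : realType}.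
Local Notation C := (cplane R).
Implicit Types (J : interval R) (w : C -> R).

(* An arc I of the unit circle is the image under t |-> e^{it} of a real
   interval J of the same length, with or without its endpoints. Zero length is
   excluded, since then S(I) is empty and w(S(I)) = 0. Length 2 pi gives the
   whole circle, possibly without one point. *)
Definition is_arc J : Prop :=
  (0 < lebesgue_measure [set` J] <= (2 * pi)%:E)%E.

Definition arc J : set C := [set cpolar 1 t | t in [set` J]].

Definition arc_length J : R := fine (lebesgue_measure [set` J]).

Definition carleson_square J : set C :=
  [set z | exists r t, [/\ z = cpolar r t, 0 <= r, arc J (cpolar 1 t) &
                           1 - arc_length J <= r < 1]].

Definition maximal w (f : C -> C) (z : C) : \bar R :=
  ereal_sup [set ((\int[areaA]_(xi in carleson_square J) (cmod (f xi) * w xi)%:E)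
                  / wmeas w (carleson_square J))%E
            | J in [set J | is_arc J /\ carleson_square J z]].

(* phi |-> [M_w(|phi|^{1/alpha})]^alpha *)
Definition maximal_power w (alpha : R) (phi : C -> C) (z : C) : \bar R :=
  (maximal w (fun xi => RtoC (cmod (phi xi) `^ alpha^-1)) z `^ alpha)%E.

(* sup_I mu(S(I)) / w(S(I))^{q/p} *)
Definition carleson_sup w (p q : R) (mu : {measure set C -> \bar R}) : \bar R :=
  ereal_sup [set (mu (carleson_square J)
                  / (wmeas w (carleson_square J)) `^ (q / p))%E
            | J in [set J | is_arc J]].

End Carleson.

Section LpSpaces.
Context {R : realType}.
Local Notation C := (cplane R).
Implicit Types (w : C -> R) (p q c : R) (mu : {measure set C -> \bar R}).

Definition Lpw_norm w p (phi : C -> C) : \bar R :=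
  ((\int[areaA]_(z in disc) (cmod (phi z) `^ p * w z)%:E) `^ p^-1)%E.

Definition Lpw w p : set (C -> C) :=
  [set phi | measurable_fun disc phi /\ (Lpw_norm w p phi < +oo)%E].

Definition Lq_norm mu q (F : C -> \bar R) : \bar R :=
  ((\int[mu]_(z in disc) (`|F z| `^ q)) `^ q^-1)%E.

Definition op_bound w p mu q (T : (C -> C) -> C -> \bar R) c : Prop :=
  0 <= c /\
  forall phi, Lpw w p phi ->
    (Lq_norm mu q (T phi) <= c%:E * Lpw_norm w p phi)%E.

Definition bounded_op w p mu q (T : (C -> C) -> C -> \bar R) : Prop :=
  exists c, op_bound w p mu q T c.

(* +oo when T is not bounded *)
Definition op_norm w p mu q (T : (C -> C) -> C -> \bar R) : \bar R :=
  ereal_inf [set c%:E | c in [set c | op_bound w p mu q T c]].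

End LpSpaces.

(* Main.v *)
Require Import Defs.
From HB Require Import structures.
From mathcomp Require Import all_boot all_order all_algebra.
From mathcomp Require Import all_classical all_reals all_analysis.
From mathcomp Require Import measurable_realfun ring lra.

Import Order.TTheory GRing.Theory Num.Theory.
Import numFieldNormedType.Exports.

Local Open Scope classical_set_scope.
Local Open Scope ring_scope.

(** The condition on mu is necessary because the maximal function of the indicator
    of a Carleson square S(I) is at least 1 on S(I); testing the operator on it
    gives mu(S(I)) <= c ^ q w(S(I)) ^ (q / p) for each admissible constant c, so the
    lower estimate holds with constant 1 ([carleson_necessary]).

    It is sufficient because M_w satisfies a weak-type estimate with respect to mu,
    and weak-type estimates interpolate. Two properties of the weight are used.
    It is invariant under rotations of the disc, which preserve area
    ([integral_rot]). It is doubling on Carleson squares ([carleson_doubling]): in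
    polar coordinates ([polar_cone]) the weight of a sector is the product of an
    angular factor and of a radial tail G(rho), the integral of s w(s) over
    [rho, 1), and the bound psi_w (r) >= (1 - r) / K near 1, which both classes of
    weights satisfy, bounds the integrand by a multiple of G(r) / (1 - r) and so
    keeps G from decreasing by more than a fixed factor between 1 - 2 l and 1 - l
    ([tail_doubling]).

    For the weak-type estimate, an arc is covered by two adjacent dyadic intervals of
    comparable length. Hence a Carleson square over which u has large average lies in
    the enlargement, by its two neighbours, of a dyadic square over which u has
    average more than eta ([heavy_region_cover]). The maximal dyadic squares Q with
    this property are disjoint up to the origin. The Carleson condition bounds the
    mu-measure of the union of their enlargements by a multiple of the sum of the
    w(Q) ^ (q / p), hence of the sum of the (eta ^ -1 int_Q u) ^ (q / p), and, as
    q / p >= 1, of (eta ^ -1 int u) ^ (q / p) ([mu_heavy_region]).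

    Finally put h = |phi| ^ (1 / alpha) and s = p alpha > 1. The set where M_w h
    exceeds lam is covered by the region that belongs to the part of h above a
    multiple of lam ([maximal_level]). Summing over lam = lam0 2 ^ i, with one factor
    of the power q / p kept and the others estimated by Chebyshev's inequality,
    leaves a geometric series, which converges because s > 1
    ([maximal_strong_type]). The maximal function is integrated against
    mu in the sense of lower integrals ([le_lower_integral]), for which it is enough
    that it lies below a series of indicators of measurable regions. *)

(** * Rotations preserve area *)
Section affine.
Context {R : realType}.
Local Notation leb := (@lebesgue_measure R).
Local Open Scope ereal_scope.

Lemma measurable_affine (a b : R) :
  measurable_fun [set: measurableTypeR R]
    (fun x : measurableTypeR R => (a * x + b)%R : measurableTypeR R).
Proof.
apply: measurable_funD => //.
Qed.

Lemma lebesgue_measure_affine (a b : R) (A : set (measurableTypeR R)) :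
  (0 < a)%R -> measurable A ->
  pushforward leb
    (fun x : measurableTypeR R => (a * x + b)%R : measurableTypeR R) A =
  (a^-1)%:E * leb A.
Proof.
move=> a0 mA.
have a'0 : (0 <= a)%R by exact: ltW.
pose phi := fun x : measurableTypeR R => (a * x + b)%R : measurableTypeR R.
have mphi : measurable_fun setT phi by exact: measurable_affine.
have := @lebesgue_measure_unique R
  (mscale (NngNum a'0) (pushforward leb phi)).
move=> /(_ mphi _ A mA) ->; last first.
  move=> _ [[x y]] _ <-.
  transitivity (a%:E * leb (phi @^-1` `]x, y]))=> //.
  rewrite (_ : _ @^-1` _ = `](((x - b) / a)%R), (((y - b) / a)%R)]%classic); last first.
    apply/seteqP; split => z /=; rewrite !in_itv/= ltr_pdivrMr// ler_pdivlMr//;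
    by rewrite ltrBlDr lerBrDr mulrC.
  rewrite !lebesgue_measure_itv/= !lte_fin ltr_pM2r ?invr_gt0// ltrD2r.
  case: ifPn => _; last by rewrite mule0.
  rewrite -!EFinD -EFinM; congr EFin.
  by field; exact: lt0r_neq0.
transitivity ((a^-1)%:E * (a%:E * pushforward leb phi A)) => //.
rewrite muleA -EFinM mulVf ?mul1e//.
exact: lt0r_neq0.
Qed.

(** The only change of variables on the line that the proof uses: with Tonelli's
    theorem it gives rotations, through shears, and polar coordinates, through
    slopes. *)
Lemma ge0_integral_affine (a b : R) (g : measurableTypeR R -> \bar R) :
  (0 < a)%R -> measurable_fun [set: measurableTypeR R] g ->
  (forall x, 0 <= g x) ->
  \int[leb]_x g (a * x + b)%R = (a^-1)%:E * \int[leb]_x g x.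
Proof.
move=> a0 mg g0.
pose phi := fun x : measurableTypeR R => (a * x + b)%R : measurableTypeR R.
have mphi : measurable_fun setT phi by exact: measurable_affine.
have := @ge0_integral_pushforward _ _ _ _ R phi mphi leb setT g measurableT mg.
rewrite preimage_setT => <-; last by move=> y _.
have a'0 : (0 <= a^-1)%R by rewrite invr_ge0 ltW.
rewrite (eq_measure_integral (mscale (NngNum a'0) leb)).
  by rewrite ge0_integral_mscale.
by move=> A mA _; exact: lebesgue_measure_affine.
Qed.

End affine.

Section plane.
Context {R : realType}.
Local Notation C := (cplane R).
Local Notation leb := (@lebesgue_measure R).
Local Notation leb2 := (@lebesgue_measure R \x @lebesgue_measure R)%E.
Local Open Scope ereal_scope.

Lemma area_tonelli_xy (F : C -> \bar R) :
  measurable_fun setT F -> (forall z, 0 <= F z) ->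
  \int[leb2]_z F z = \int[leb]_x \int[leb]_y F (x, y).
Proof. by move=> mF F0; rewrite fubini_tonelli1. Qed.

Lemma area_tonelli_yx (F : C -> \bar R) :
  measurable_fun setT F -> (forall z, 0 <= F z) ->
  \int[leb2]_z F z = \int[leb]_y \int[leb]_x F (x, y).
Proof. by move=> mF F0; rewrite fubini_tonelli1// fubini_tonelli. Qed.

Definition shear_x (c : R) (z : C) : C := ((z.1 + c * z.2)%R, z.2).
Definition shear_y (c : R) (z : C) : C := (z.1, (z.2 + c * z.1)%R).

Lemma measurable_pairC (f g : C -> measurableTypeR R) :
  measurable_fun setT f -> measurable_fun setT g ->
  measurable_fun setT (fun z => (f z, g z) : C).
Proof. by move=> mf mg; exact: measurable_fun_pair. Qed.

Lemma measurable_lin (a b : R) :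
  measurable_fun [set: C] (fun z : C => (a * z.1 + b * z.2)%R : measurableTypeR R).
Proof.
apply: measurable_funD => //.
  by apply: measurable_funM => //; exact: measurable_fst.
by apply: measurable_funM => //; exact: measurable_snd.
Qed.

Lemma measurable_shear_x c : measurable_fun setT (shear_x c).
Proof.
apply: measurable_pairC; last exact: measurable_snd.
rewrite (_ : (fun _ => _) = fun z : C => (1 * z.1 + c * z.2)%R).
  exact: measurable_lin.
by apply/funext => z; rewrite mul1r.
Qed.

Lemma measurable_shear_y c : measurable_fun setT (shear_y c).
Proof.
apply: measurable_pairC; first exact: measurable_fst.
rewrite (_ : (fun _ => _) = fun z : C => (c * z.1 + 1 * z.2)%R).
  exact: measurable_lin.
by apply/funext => z; rewrite mul1r addrC.
Qed.

Lemma measurable_section_l (F : C -> \bar R) (y : R) :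
  measurable_fun setT F ->
  measurable_fun [set: measurableTypeR R] (fun x : measurableTypeR R => F (x, y)).
Proof.
by move=> mF; apply: measurableT_comp => //; exact: measurable_pair2.
Qed.

Lemma measurable_section_r (F : C -> \bar R) (x : R) :
  measurable_fun setT F ->
  measurable_fun [set: measurableTypeR R] (fun y : measurableTypeR R => F (x, y)).
Proof.
by move=> mF; apply: measurableT_comp => //; exact: measurable_pair1.
Qed.

(** Tonelli's theorem reduces a shear to a translation of each horizontal line. *)
Lemma integral_shear_x c (F : C -> \bar R) :
  measurable_fun setT F -> (forall z, 0 <= F z) ->
  \int[leb2]_z F (shear_x c z) = \int[leb2]_z F z.
Proof.
move=> mF F0; rewrite !area_tonelli_yx//.
  apply: eq_integral => y _; rewrite /shear_x/=.
  have := @ge0_integral_affine R 1 (c * y) (fun x => F (x, y)) ltr01.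
  rewrite invr1 mul1e => <- //; last exact: measurable_section_l.
  by apply: eq_integral => x _; rewrite mul1r.
by apply: measurableT_comp => //; exact: measurable_shear_x.
Qed.

Lemma integral_shear_y c (F : C -> \bar R) :
  measurable_fun setT F -> (forall z, 0 <= F z) ->
  \int[leb2]_z F (shear_y c z) = \int[leb2]_z F z.
Proof.
move=> mF F0; rewrite !area_tonelli_xy//.
  apply: eq_integral => x _; rewrite /shear_y/=.
  have := @ge0_integral_affine R 1 (c * x) (fun y => F (x, y)) ltr01.
  rewrite invr1 mul1e => <- //; last exact: measurable_section_r.
  by apply: eq_integral => y _; rewrite mul1r.
by apply: measurableT_comp => //; exact: measurable_shear_y.
Qed.

Definition rot (t : R) (z : C) : C :=
  ((cos t * z.1 + (- sin t) * z.2)%R, (sin t * z.1 + cos t * z.2)%R).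

Lemma measurable_rot t : measurable_fun setT (rot t).
Proof. by apply: measurable_pairC; exact: measurable_lin. Qed.

Lemma rot_rot s t z : rot s (rot t z) = rot (s + t) z.
Proof.
rewrite /rot/= sinD cosD; congr pair; ring.
Qed.

(** The coefficient of the outer shears is - tan (t / 2), for which the half-angle
    formula sin t / (1 + cos t) excludes t = pi. *)
Lemma rot_shears t z : (1 + cos t != 0)%R ->
  rot t z = shear_x (- (sin t / (1 + cos t))) (shear_y (sin t)
    (shear_x (- (sin t / (1 + cos t))) z)).
Proof.
move=> c1; rewrite /rot /shear_x /shear_y/=.
have s2 : ((sin t) ^+ 2 = (1 + cos t) * (1 - cos t))%R.
  by rewrite sin2cos2; ring.
have e1 : (sin t * (sin t / (1 + cos t)) = 1 - cos t)%R.
  by rewrite mulrA -expr2 s2; field.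
have e2 : ((sin t / (1 + cos t)) * (1 + cos t) = sin t)%R by field.
set u := (sin t / (1 + cos t))%R in e1 e2 *.
congr pair.
  transitivity (z.1 + (- (2 * u)) * z.2 + (- (sin t * u)) * z.1 +
    (u * (sin t * u)) * z.2)%R; last by ring.
  rewrite e1.
  transitivity (cos t * z.1 + (- (u * (1 + cos t))) * z.2)%R; first by rewrite e2.
  ring.
transitivity (sin t * z.1 + (1 - sin t * u) * z.2)%R; last by ring.
by rewrite e1; ring.
Qed.

(** A rotation factors into three shears; the half turn, for which the
    factorization degenerates, is a quarter turn performed twice. *)
Lemma integral_rot t (F : C -> \bar R) :
  measurable_fun setT F -> (forall z, 0 <= F z) ->
  \int[leb2]_z F (rot t z) = \int[leb2]_z F z.
Proof.
have main s G : (1 + cos s != 0)%R -> measurable_fun setT G ->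
    (forall z, 0 <= G z) -> \int[leb2]_z G (rot s z) = \int[leb2]_z G z.
  move=> c1 mG G0.
  under eq_integral do rewrite rot_shears//.
  rewrite (integral_shear_x _ (fun z => G (shear_x _ (shear_y _ z))))//; last first.
    exact: (measurableT_comp (measurableT_comp mG (measurable_shear_x _))
      (measurable_shear_y _)).
  rewrite (integral_shear_y _ (fun z => G (shear_x _ z))) ?integral_shear_x//.
  by apply: measurableT_comp => //; exact: measurable_shear_x.
move=> mF F0.
have [c1|c1] := eqVneq (1 + cos t)%R 0%R; last exact: main.
have c2 : (1 + cos (t / 2) != 0)%R.
  apply/eqP => c; have {}c : (cos (t / 2) = -1)%R by lra.
  have /eqP : (sin (t / 2) ^+ 2 = 0)%R by rewrite sin2cos2 c; ring.
  rewrite sqrf_eq0 => /eqP s0.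
  by move: c1; rewrite (splitr t) cosD c s0; lra.
rewrite -[RHS](main _ _ c2 mF F0) -[RHS](main _ (fun z => F (rot _ z)) c2)//.
  by apply: eq_integral => z _; rewrite rot_rot -splitr.
by apply: measurableT_comp => //; exact: measurable_rot.
Qed.

End plane.

(** * Polar coordinates in a cone *)
Section polar.
Context {R : realType}.
Local Notation C := (cplane R).
Local Notation leb := (@lebesgue_measure R).
Local Notation leb2 := (@lebesgue_measure R \x @lebesgue_measure R)%E.

Lemma measurable_sqrt :
  measurable_fun [set: measurableTypeR R]
    (Num.sqrt : measurableTypeR R -> measurableTypeR R).
Proof. by apply: continuous_measurable_fun; exact: sqrt_continuous. Qed.

Lemma measurable_cmod :
  measurable_fun [set: C] (cmod : C -> measurableTypeR R).
Proof.
apply: (measurableT_comp measurable_sqrt).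
apply: measurable_funD; apply: measurable_funX.
  exact: measurable_fst.
exact: measurable_snd.
Qed.

(** The cone of the points of argument less than atan M in absolute value. The
    inequality between coordinates makes its measurability plain; when M > 0, it
    forces the first coordinate to be positive. *)
Definition cone (M : R) : set C := [set z | `|z.2 : R| < M * z.1].

Lemma measurable_cone M : measurable (cone M).
Proof.
rewrite -[cone M]setTI; apply: measurable_fun_ltr => //.
  by apply: measurableT_comp => //; exact: measurable_snd.
by apply: measurable_funM => //; exact: measurable_fst.
Qed.

(** The angle 2 atan M of the cone, in the form in which the slope coordinate
    produces it. *)
Definition cone_aperture (M : R) : R :=
  fine (\int[leb]_(m in `](- M)%R, M[%classic) ((1 + m ^+ 2)^-1)%R%:E)%E.

Local Open Scope ereal_scope.

Lemma measurable_oneDsqrV :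
  measurable_fun [set: measurableTypeR R]
    (fun m : measurableTypeR R => ((1 + m ^+ 2)^-1)%R : measurableTypeR R).
Proof. by apply: continuous_measurable_fun; exact: continuous_oneDsqrV. Qed.

Lemma cone_apertureE M : (0 < M)%R ->
  (cone_aperture M)%:E = \int[leb]_(m in `](- M)%R, M[%classic) (((1 + m ^+ 2)^-1)%R%:E).
Proof.
move=> M0; rewrite fineK// ge0_fin_numE; last first.
  by apply: integral_ge0 => m _; rewrite lee_fin invr_ge0 addr_ge0// sqr_ge0.
apply: (@le_lt_trans _ _ (\int[leb]_(m in `](- M)%R, M[%classic) (1%R%:E))).
  apply: ge0_le_integral => //=.
  - by move=> m _; rewrite lee_fin invr_ge0 addr_ge0// sqr_ge0.
  - apply/measurable_EFinP; apply: measurable_funTS; exact: measurable_oneDsqrV.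
  - move=> m _; rewrite lee_fin; exact: oneDsqrV_le1.
rewrite integral_cst//= lebesgue_measure_itv/=; case: ifP => _.
  by rewrite -EFinD mul1e ltry.
by rewrite mule0.
Qed.

Lemma cone_aperture_gt0 M : (0 < M)%R -> (0 < cone_aperture M)%R.
Proof.
move=> M0; rewrite -lte_fin cone_apertureE//.
apply: (@lt_le_trans _ _ (\int[leb]_(m in `](- M)%R, M[%classic) (((1 + M ^+ 2)^-1)%R%:E))).
  rewrite integral_cst//= lebesgue_measure_itv/= lte_fin gtrN// -EFinD -EFinM lte_fin.
  by rewrite mulr_gt0 ?subr_gt0 ?gtrN// invr_gt0 ltr_pwDl// sqr_ge0.
apply: ge0_le_integral => //=.
- by move=> m _; rewrite lee_fin invr_ge0 addr_ge0// sqr_ge0.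
- apply/measurable_EFinP; apply: measurable_funTS; exact: measurable_oneDsqrV.
- move=> m; rewrite in_itv/= => /andP[m1 m2]; rewrite lee_fin lef_pV2 ?posrE.
  + by rewrite lerD2l -(real_normK (num_real m)) lerXn2r ?nnegrE// ?ltW// ltr_norml m1.
  + by rewrite ltr_pwDl// sqr_ge0.
  + by rewrite ltr_pwDl// sqr_ge0.
Qed.

Lemma cmod_slope (x m : R) : (0 < x)%R ->
  cmod (x, x * m)%R = (Num.sqrt (1 + m ^+ 2) * x)%R.
Proof.
move=> x0; rewrite /cmod/= exprMn -{1}(mulr1 (x ^+ 2)%R) -mulrDr sqrtrM ?sqr_ge0//.
by rewrite sqrtr_sqr gtr0_norm// mulrC.
Qed.

(** Polar coordinates with the slope m = y / x in place of the angle: y = x m is a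
    dilation for fixed x, and after an exchange of the order of integration
    s = x sqrt (1 + m ^ 2) is a dilation for fixed m. The two Jacobians leave
    s ds dm / (1 + m ^ 2). *)
Lemma polar_cone M (f : measurableTypeR R -> \bar R) : (0 < M)%R ->
  measurable_fun setT f -> (forall s, 0 <= f s) ->
  \int[leb2]_(z in cone M) f (cmod z) =
  (cone_aperture M)%:E * \int[leb]_(s in `]0%R, +oo[%classic) (s%:E * f s).
Proof.
move=> M0 mf f0.
pose D : set C := [set z | (0 < z.1)%R /\ (`|z.2 : R| < M)%R].
have mD : measurable D.
  apply: measurableI; rewrite -[X in measurable X]setTI.
    by apply: measurable_fun_ltr => //; exact: measurable_fst.
  apply: measurable_fun_ltr => //.
  by apply: measurableT_comp => //; exact: measurable_snd.
pose H := (fun z : C => (z.1 : R)%:E * f (Num.sqrt (1 + z.2 ^+ 2) * z.1)%R) \_ D.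
have H0 z : 0 <= H z.
  by apply: erestrict_ge0 => {}z [z0 _]; rewrite mule_ge0// lee_fin ltW.
have mH : measurable_fun setT H.
  apply/(measurable_restrictT _ mD); apply: measurable_funTS.
  apply: emeasurable_funM.
    by apply/measurable_EFinP; exact: measurable_fst.
  apply: measurableT_comp => //; apply: measurable_funM; last exact: measurable_fst.
  apply: (measurableT_comp measurable_sqrt); apply: measurable_funD => //.
  by apply: measurable_funX; exact: measurable_snd.
pose F := (fun z : C => f (cmod z)) \_ (cone M).
have F0 z : 0 <= F z by apply: erestrict_ge0.
have mF : measurable_fun setT F.
  apply/(measurable_restrictT _ (measurable_cone M)); apply: measurable_funTS.
  by apply: measurableT_comp => //; exact: measurable_cmod.
pose k := (fun s : measurableTypeR R => s%:E * f s) \_ `]0%R, +oo[%classic.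
have k0 s : 0 <= k s.
  apply: erestrict_ge0 => {}s; rewrite /= in_itv/= andbT => s0.
  by rewrite mule_ge0// lee_fin ltW.
have mk : measurable_fun setT k.
  apply/(measurable_restrictT _ (measurable_itv _)); apply: measurable_funTS.
  by apply: emeasurable_funM => //; exact/measurable_EFinP.
rewrite integral_mkcond -/F area_tonelli_xy//.
transitivity (\int[leb]_x \int[leb]_y H (x, y)).
  apply: eq_integral => x _.
  have [x0|x0] := ltP 0%R x; last first.
    rewrite !integral0_eq// => y _; rewrite /H /F patchE memNset//=.
      by move=> [] /=; rewrite ltNge x0.
    by rewrite /cone/= => /(le_lt_trans (normr_ge0 _)); rewrite pmulr_rgt0// ltNge x0.
  have := @ge0_integral_affine R x 0%R (fun y => F (x, y)) x0.
  move=> /(_ (measurable_section_r _ _ mF) (fun _ => F0 _)) => E.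
  transitivity (x%:E * ((x^-1)%:E * \int[leb]_y F (x, y))).
    by rewrite muleA -EFinM divff ?mul1e// gt_eqF.
  rewrite -E -ge0_integralZl//; last 2 first.
  - apply: (measurableT_comp (measurable_section_r _ x mF)).
    exact: measurable_affine.
  - by rewrite lee_fin ltW.
  apply: eq_integral => m _; rewrite addr0 /F /H !patchE.
  have -> : ((x, (x * m)%R) \in cone M) = ((x, m) \in D).
    apply/idP/idP; rewrite !inE /cone /D/= normrM (gtr0_norm x0) (mulrC x) ltr_pM2r//.
    by case.
  case: ifP => _; last by rewrite mule0.
  by rewrite cmod_slope.
rewrite -area_tonelli_xy// area_tonelli_yx//.
rewrite cone_apertureE//.
rewrite -ge0_integralZr//=; last 3 first.
- apply/measurable_EFinP; apply: measurable_funTS; exact: measurable_oneDsqrV.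
- by move=> m _; rewrite lee_fin invr_ge0 addr_ge0// sqr_ge0.
- by apply: integral_ge0 => s; rewrite /= in_itv/= andbT => s0; rewrite mule_ge0// lee_fin ltW.
rewrite [RHS]integral_mkcond; apply: eq_integral => m _; rewrite patchE.
case: ifPn => [|mM]; last first.
  rewrite integral0_eq// => x _; rewrite /H patchE memNset// => -[_ /= xM].
  by move/negP : mM; apply; rewrite inE/= in_itv/= -ltr_norml.
rewrite inE/= in_itv/= -ltr_norml => mM.
set a := Num.sqrt (1 + m ^+ 2).
have a0 : (0 < a)%R by rewrite sqrtr_gt0 ltr_pwDl// sqr_ge0.
rewrite [in RHS]integral_mkcond -/k.
transitivity ((a^-1)%:E * ((a^-1)%:E * \int[leb]_s k s)); last first.
  by rewrite muleA -EFinM -invfM -expr2 sqr_sqrtr// addr_ge0// sqr_ge0.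
have := @ge0_integral_affine R a 0%R k a0 mk k0 => <-.
rewrite -ge0_integralZl//; last 2 first.
- by apply: (measurableT_comp mk); exact: measurable_affine.
- by rewrite lee_fin invr_ge0 ltW.
apply: eq_integral => x _; rewrite addr0 /H /k !patchE/=.
have -> : ((x, m) \in D) = ((a * x)%R \in `]0%R, +oo[%classic).
  apply/idP/idP; rewrite !inE /D/= in_itv/= andbT pmulr_rgt0//.
  by case.
case: ifP => _; last by rewrite mule0.
by rewrite muleA -EFinM mulrA mulVf ?mul1r// gt_eqF.
Qed.

End polar.

(** * Radial weights on sectors *)
Section weight.
Context {R : realType}.
Local Notation C := (cplane R).
Local Notation leb := (@lebesgue_measure R).
Local Notation leb2 := (@lebesgue_measure R \x @lebesgue_measure R)%E.
Local Open Scope ereal_scope.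
Implicit Types (w : C -> R).

Lemma measurable_disc : measurable (disc : set C).
Proof.
rewrite -[disc]setTI; apply: measurable_fun_ltr => //.
exact: measurable_cmod.
Qed.

Lemma cmod_ge0 (z : C) : (0 <= cmod z)%R. Proof. exact: sqrtr_ge0. Qed.

Lemma cmod_RtoC (x : R) : cmod (RtoC x : C) = `|x|%R.
Proof. by rewrite /cmod /RtoC/= expr0n/= addr0 sqrtr_sqr. Qed.

Lemma weight_measurable w : weight w -> measurable_fun disc (EFin \o w).
Proof. by case=> _ /integrableP[]. Qed.

Lemma weight_ge0 w : weight w -> forall z, disc z -> 0 <= (w z)%:E.
Proof. by case=> w0 _ z /w0 /ltW; rewrite lee_fin. Qed.

Lemma measurable_RtoC :
  measurable_fun [set: measurableTypeR R] (RtoC : measurableTypeR R -> C).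
Proof. by apply: measurable_fun_pair. Qed.

(** The moduli of the nonzero points of the disc outside the circle of radius rho.
    A negative rho is allowed, because the inner radius 1 - |I| of a Carleson
    square may be negative. *)
Definition radii (rho : R) : set (measurableTypeR R) :=
  [set s | (0 < s < 1)%R /\ (rho <= s)%R].

Lemma measurable_radii rho : measurable (radii rho).
Proof.
rewrite [radii rho](_ : _ = `]0%R, 1%R[%classic `&` `[rho, +oo[%classic).
  exact: measurableI.
by apply/seteqP; split => s /=; rewrite /radii/= !in_itv/= andbT.
Qed.

Lemma disc_RtoC (s : R) : (0 <= s < 1)%R -> disc (RtoC s : C).
Proof. by move=> /andP[s0 s1]; rewrite /disc/= cmod_RtoC ger0_norm. Qed.

Lemma measurable_profile w (A : set (measurableTypeR R)) : weight w -> measurable A ->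
  (forall s, A s -> (0 <= s < 1)%R) ->
  measurable_fun A (fun s : measurableTypeR R => (w (RtoC s))%:E).
Proof.
move=> /weight_measurable mw mA A01.
apply: (@measurable_comp _ _ _ _ _ _ disc (EFin \o w)) => //.
- exact: measurable_disc.
- by move=> _ [s As <-]; exact/disc_RtoC/A01.
- apply: measurable_funTS; exact: measurable_RtoC.
Qed.

(** The radial factor of the weight of a sector; the factor s is the Jacobian of
    polar coordinates. *)
Definition tail w (rho : R) : \bar R :=
  \int[leb]_(s in radii rho) (s * w (RtoC s))%R%:E.

Lemma measurable_tail_integrand w (A : set (measurableTypeR R)) : weight w -> measurable A ->
  (forall s, A s -> (0 <= s < 1)%R) ->
  measurable_fun A (fun s : measurableTypeR R => (s * w (RtoC s))%R%:E).
Proof.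
move=> ww mA A01; under eq_fun do rewrite EFinM.
apply: emeasurable_funM; first exact/measurable_EFinP.
exact: measurable_profile.
Qed.

Lemma tail_integrand_ge0 w s : weight w -> (0 <= s < 1)%R ->
  0 <= (s * w (RtoC s))%R%:E.
Proof.
move=> ww s01; rewrite EFinM mule_ge0//; first by case/andP: s01.
exact/weight_ge0/disc_RtoC.
Qed.

Lemma radii01 rho s : radii rho s -> (0 <= s < 1)%R.
Proof. by move=> [/andP[/ltW -> ->]]. Qed.

Lemma tail_ge0 w rho : weight w -> 0 <= tail w rho.
Proof.
by move=> ww; apply: integral_ge0 => s /radii01; exact: tail_integrand_ge0.
Qed.

Lemma le_tail w rho rho' : weight w -> (rho <= rho')%R ->
  tail w rho' <= tail w rho.
Proof.
move=> ww rr; apply: ge0_subset_integral.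
- exact: measurable_radii.
- exact: measurable_radii.
- apply: measurable_tail_integrand => //; first exact: measurable_radii.
  exact: radii01.
- by move=> s /radii01; exact: tail_integrand_ge0.
- by move=> s [s01 rs]; split => //; exact: le_trans rs.
Qed.

Lemma tail_gt0 w rho : weight w -> (rho < 1)%R -> 0 < tail w rho.
Proof.
move=> ww r1; rewrite lt0e tail_ge0// andbT; apply/negP => /eqP t0.
have mf : measurable_fun (radii rho) (fun s : measurableTypeR R => (s * w (RtoC s))%R%:E).
  apply: measurable_tail_integrand => //; first exact: measurable_radii.
  exact: radii01.
have /(ae_eq_integral_abs _ (measurable_radii rho)) := mf.
move=> /(_ leb)[+ _].
rewrite -[X in X = _ -> _](_ : tail w rho = _); last first.
  apply: eq_integral => s; rewrite inE => /radii01 s01.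
  by rewrite gee0_abs// tail_integrand_ge0.
move=> /(_ t0)[N [mN N0 sub]].
have : leb (radii rho) <= leb N.
  apply: le_measure; rewrite ?inE//; first exact: measurable_radii.
  move=> s sr; apply: sub => /= /(_ sr) => -[] /eqP.
  rewrite mulf_eq0 => /orP[/eqP s0|/eqP s0].
    by case: sr; rewrite s0 ltxx.
  by have := ww.1 _ (disc_RtoC _ (radii01 _ _ sr)); rewrite s0 ltxx.
rewrite N0 leNgt => /negP; apply.
pose a := Order.max (2^-1)%R rho.
have a1 : (a < 1)%R by rewrite /a gt_max r1 andbT invf_lt1// ltr1n.
apply: (@lt_le_trans _ _ (leb `[a, 1%R[%classic)).
  by rewrite lebesgue_measure_itv/= lte_fin a1 -EFinD lte_fin subr_gt0.
apply: le_measure; rewrite ?inE//; first exact: measurable_radii.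
move=> s; rewrite /= in_itv/= ge_max => /andP[/andP[s2 rs] s1]; split => //.
by rewrite s1 andbT (lt_le_trans _ s2).
Qed.

Definition sector (M rho : R) : set C :=
  [set z | [/\ cone M z, (rho <= cmod z)%R & disc z]].

Lemma measurable_cmod_ge (rho : R) : measurable [set z : C | (rho <= cmod z)%R].
Proof.
by rewrite -[X in measurable X]setTI; apply: measurable_fun_ler => //; exact: measurable_cmod.
Qed.

Lemma measurable_sector M rho : measurable (sector M rho).
Proof.
rewrite [sector M rho](_ : _ = cone M `&` ([set z | (rho <= cmod z)%R] `&` disc)).
  apply: measurableI; first exact: measurable_cone.
  by apply: measurableI; [exact: measurable_cmod_ge|exact: measurable_disc].
by apply/seteqP; split => [z []|z [? []]].
Qed.

Lemma cone_gt0 M (z : C) : (0 < M)%R -> cone M z -> (0 < cmod z)%R.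
Proof.
rewrite /cone/= => M0 /(le_lt_trans (normr_ge0 _)); rewrite pmulr_rgt0// => z0.
by rewrite sqrtr_gt0 ltr_pwDl ?exprn_gt0// sqr_ge0.
Qed.

Lemma integral_areaA (A : set C) (f : C -> \bar R) : measurable A ->
  measurable_fun A f -> (forall z, A z -> 0 <= f z) ->
  \int[areaA]_(z in A) f z = ((pi : R)^-1)%:E * \int[leb2]_(z in A) f z.
Proof. by move=> mA mf f0; rewrite ge0_integral_mscale. Qed.

(** Through this factorization the estimates on weights of squares become
    estimates on the function [tail] of one variable. *)
Lemma wmeas_sector w M rho : weight w -> radial w -> (0 < M)%R ->
  wmeas w (sector M rho) = (pi^-1 * cone_aperture M)%:E * tail w rho.
Proof.
move=> ww rw M0; rewrite /wmeas.
have sd : sector M rho `<=` disc by move=> z [].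
have ms := measurable_sector M rho.
rewrite integral_areaA//; last 2 first.
- exact: measurable_funS measurable_disc sd (weight_measurable _ ww).
- by move=> z /sd; exact: weight_ge0.
rewrite EFinM -muleA; congr (_ * _).
pose f := (fun s : measurableTypeR R => (w (RtoC s))%:E) \_ (radii rho).
have mf : measurable_fun setT f.
  apply/(measurable_restrictT _ (measurable_radii rho)).
  apply: measurable_profile => //; first exact: measurable_radii.
  exact: radii01.
have f0 s : 0 <= f s.
  by apply: erestrict_ge0 => {}s /radii01 s01; exact/weight_ge0/disc_RtoC.
transitivity (\int[leb2]_(z in cone M) f (cmod z)); last first.
  rewrite polar_cone//; congr (_ * _); rewrite /tail integral_mkcond [RHS]integral_mkcond.
  apply: eq_integral => s _; rewrite /f !patchE.
  have [s0|s0] := ltP 0%R s; last first.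
    by rewrite !memNset//= ?in_itv/= ?andbT ?leNgt -?leNgt// => -[]; rewrite ltNge s0.
  have -> : s \in `]0%R, +oo[%classic by rewrite inE/= in_itv/= s0.
  by case: ifP => _; rewrite ?mule0// EFinM.
rewrite integral_mkcond [RHS]integral_mkcond; apply: eq_integral => z _.
rewrite /f !patchE; have [zc|zc] := boolP (z \in cone M); last first.
  by rewrite ifF//; apply/negbTE; apply: contra zc; rewrite !inE => -[].
move: zc; rewrite inE => zc; have z0 := cone_gt0 _ _ M0 zc.
have [/andP[rz z1]|zn] := boolP ((rho <= cmod z) && (cmod z < 1))%R.
  have -> : z \in sector M rho by rewrite inE.
  have -> : cmod z \in radii rho by rewrite inE; split => //; apply/andP.
  by rewrite (rw _ z1).
have -> : z \in sector M rho = false.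
  by apply/negbTE; apply: contra zn; rewrite inE => -[_ -> ?]; exact/andP.
have -> : cmod z \in radii rho = false.
  by apply/negbTE; apply: contra zn; rewrite inE => -[/andP[_ ->] ->].
by [].
Qed.

Lemma wmeas_disc_fin w : weight w -> wmeas w disc < +oo.
Proof.
move=> ww; have [_ /integrableP[_]] := ww; apply: le_lt_trans.
apply: ge0_le_integral => //.
- exact: measurable_disc.
- by move=> z; exact: weight_ge0.
- exact: weight_measurable.
- by apply: measurableT_comp => //; exact: weight_measurable.
- by move=> z _; exact: lee_abs.
Qed.

Lemma wmeas_ge0 w (A : set C) : weight w -> A `<=` disc -> 0 <= wmeas w A.
Proof.
by move=> ww Ad; apply: integral_ge0 => z /Ad; exact: weight_ge0.
Qed.

Lemma le_wmeas w (A B : set C) : weight w -> measurable A -> measurable B ->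
  A `<=` B -> B `<=` disc -> wmeas w A <= wmeas w B.
Proof.
move=> ww mA mB AB Bd; apply: ge0_subset_integral => //.
- exact: measurable_funS measurable_disc Bd (weight_measurable _ ww).
- by move=> z /Bd; exact: weight_ge0.
Qed.

(** Integrability of w over the disc, read on the sector of slope 1. *)
Lemma tail_fin w rho : weight w -> radial w -> tail w rho \is a fin_num.
Proof.
move=> ww rw; rewrite ge0_fin_numE ?tail_ge0//.
have : wmeas w (sector 1 rho) < +oo.
  apply: le_lt_trans (wmeas_disc_fin _ ww); apply: le_wmeas => //.
  - exact: measurable_sector.
  - exact: measurable_disc.
  - by move=> z [].
rewrite wmeas_sector//.
have p0 : (0 < pi^-1 * cone_aperture (1 : R))%R.
  by rewrite mulr_gt0 ?invr_gt0 ?pi_gt0 ?cone_aperture_gt0.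
move=> h; rewrite ltey; apply/eqP => E; move: h.
by rewrite E gt0_muley// lte_fin.
Qed.

End weight.

(** * Doubling of the tail *)
Section doubling.
Context {R : realType}.
Local Notation C := (cplane R).
Local Notation leb := (@lebesgue_measure R).
Local Open Scope ereal_scope.
Implicit Types (w : C -> R).

(** What the two classes of weights have in common: psi_w (r) >= (1 - r) / K for r
    close to 1. The doubling property rests on this lower bound. *)
Definition regular_near_1 w (r0 K : R) : Prop := 
  forall r : R, (r0 <= r < 1)%R ->
  ((1 - r) * w (RtoC r))%:E <=
    K%:E * \int[leb]_(s in `[r, 1%R[%classic) (w (RtoC s))%:E.

Lemma class_I_regular w : class_I w ->
  exists r0 K : R, [/\ (2^-1 <= r0 < 1)%R, (0 < K)%R & regular_near_1 w r0 K].
Proof.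
move=> [[[w0 wi] rw _] wlim].
have /cvgeyPge /(_ 1%R) := wlim.
rewrite /at_left near_withinE => /nbhs_ballP[e /= e0 He].
exists (Num.max 2^-1 (1 - e / 2))%R, 1%R; split => //.
  by rewrite le_max lexx/= gt_max invf_lt1// ltr1n/= ltrBlDr ltrDl divr_gt0.
move=> r /andP[]; rewrite ge_max => /andP[r2 re] r1.
have r0 : (0 <= r)%R by apply: le_trans r2.
have wr : (0 < w (RtoC r))%R by apply/w0/disc_RtoC; rewrite r0.
have := He r; rewrite /ball/= gtr0_norm ?subr_gt0// => /(_ _ r1).
have -> : (1 - r < e)%R.
  by rewrite ltrBlDr -ltrBlDl (lt_le_trans _ re)// ltrD2l ltrN2 ltr_pdivrMr// ltr_pMr// ltr1n.
move=> /(_ isT); rewrite /psi mul1e.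
set I := (\int[_]_(_ in _) _) => H.
have r1' : (0 < 1 - r)%R by rewrite subr_gt0.
have : ((1 - r) * w (RtoC r))%:E * 1 <= ((1 - r) * w (RtoC r))%:E *
   ((w (RtoC r))^-1%:E * I * ((1 - r)^-1)%:E).
  by apply: lee_wpmul2l => //; rewrite lee_fin ltW// mulr_gt0.
rewrite mule1 => /le_trans; apply.
rewrite muleC -muleA -EFinM (muleC _ I) -muleA -EFinM.
rewrite (_ : (_ * _)%R = 1%R) ?mule1//.
by field; rewrite !gt_eqF.
Qed.

Lemma class_R_regular w : class_R w ->
  exists r0 K : R, [/\ (2^-1 <= r0 < 1)%R, (0 < K)%R & regular_near_1 w r0 K].
Proof.
move=> [[[w0 wi] rw _] [K [K1 HK]]].
have K0 : (0 < K)%R by exact: lt_le_trans K1.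
exists 2^-1%R, K; split => //; first by rewrite lexx invf_lt1// ltr1n.
move=> r /andP[r2 r1].
have r0 : (0 <= r)%R by apply: le_trans r2.
have wr : (0 < w (RtoC r))%R by apply/w0/disc_RtoC; rewrite r0.
have := HK r; rewrite r0 r1 => /(_ isT)/andP[+ _].
rewrite /psi; set I := (\int[_]_(_ in _) _) => H.
have : (K * w (RtoC r))%:E * (K^-1 * (1 - r))%:E <=
       (K * w (RtoC r))%:E * ((w (RtoC r))^-1%:E * I).
  by apply: lee_wpmul2l => //; rewrite lee_fin ltW// mulr_gt0.
rewrite muleA -!EFinM.
rewrite (_ : (_ * w _ * (w _)^-1)%R = K); last by field; rewrite gt_eqF.
apply: le_trans; rewrite lee_fin le_eqVlt; apply/orP; left; apply/eqP.
by field; rewrite gt_eqF.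
Qed.

Variable w : C -> R.
Hypothesis ww : weight w.
Hypothesis rw : radial w.

Lemma radii_itv (r : R) : (0 < r)%R -> radii r = `[r, 1%R[%classic.
Proof.
move=> r0; apply/seteqP; split => s; rewrite /radii/= in_itv/=.
  by move=> [/andP[_ ->] ->].
by move=> /andP[rs s1]; rewrite rs s1 (lt_le_trans r0).
Qed.

(** The Jacobian s is at least 1/2 here. *)
Lemma le_integral_tail (r : R) : (2^-1 <= r)%R -> 
  \int[leb]_(s in `[r, 1%R[%classic) (w (RtoC s))%:E <= 2%:E * tail w r.
Proof.
move=> r2; have r0 : (0 < r)%R by apply: lt_le_trans r2.
have s01 s : radii r s -> (0 <= s < 1)%R by exact: radii01.
have mr := measurable_radii r.
rewrite -radii_itv// /tail -ge0_integralZl//; last 2 first.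
- exact: measurable_tail_integrand.
- by move=> s /s01; exact: tail_integrand_ge0.
apply: ge0_le_integral => //.
- by move=> s /s01 ss; exact/weight_ge0/disc_RtoC.
- exact: measurable_profile.
- apply: emeasurable_funM => //; exact: measurable_tail_integrand.
- move=> s rs; rewrite -EFinM lee_fin mulrA ler_peMl//.
    by rewrite -lee_fin; exact/weight_ge0/disc_RtoC/s01.
  by case: rs => _ rs; have := le_trans r2 rs; lra.
Qed.

Variables (r0 K : R).
Hypothesis r0_itv : (2^-1 <= r0 < 1)%R.
Hypothesis K0 : (0 < K)%R.
Hypothesis wreg : regular_near_1 w r0 K.

Local Notation G := (fun r => fine (tail w r)).

Lemma tailE r : tail w r = (G r)%:E.
Proof. by rewrite fineK// tail_fin. Qed.

Lemma weight_le_tail (r : R) : (r0 <= r < 1)%R ->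
  ((1 - r) * w (RtoC r) <= 2 * K * G r)%R.
Proof.
move=> rr; have := wreg _ rr; rewrite -lee_fin => /le_trans; apply.
rewrite EFinM -tailE mulrC EFinM -muleA.
apply: lee_wpmul2l; first by rewrite lee_fin ltW.
apply: le_integral_tail; case/andP: r0_itv => r02 _; case/andP: rr => rr _.
exact: le_trans rr.
Qed.

(** On [a, b) the integrand is at most 2 K G(a) / (1 - b), so if b - a is small
    compared with 1 - b then [a, b) carries at most half of G(a). This replaces the
    differential inequality -G' <= 2 K G / (1 - r). *)
Lemma tail_step (a b : R) : (r0 <= a)%R -> (a < b < 1)%R ->
  ((b - a) * (4 * K) <= 1 - b)%R -> (G a <= 2 * G b)%R.
Proof.
move=> ra /andP[ab b1] small.
have a0 : (0 < a)%R by case/andP: r0_itv => h _; apply: lt_le_trans ra; exact: lt_le_trans h.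
have b0 : (0 < b)%R by exact: lt_trans ab.
have b1' : (0 < 1 - b)%R by rewrite subr_gt0.
have Ga0 : (0 <= G a)%R by rewrite fine_ge0// tail_ge0.
have sub s : (`[a, b[%classic : set R) s -> (0 <= s < 1)%R.
  by rewrite /= in_itv/= => /andP[as_ sb]; rewrite (le_trans (ltW a0))// (lt_trans sb).
set g := G a in Ga0 *.
have : tail w a <= ((b - a) * (2 * K * g / (1 - b)))%:E + tail w b.
  rewrite /tail (radii_itv _ b0) (radii_itv _ a0).
  have -> : `[a, 1%R[%classic = `[a, b[%classic `|` `[b, 1%R[%classic :> set R.
    by apply/seteqP; split => s; rewrite /= !in_itv/=; lra.
  rewrite ge0_integral_setU//; last 3 first.
  - apply: measurable_tail_integrand => //.
      by apply: measurableU; exact: measurable_itv.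
    move=> s [/sub//|]; rewrite /= in_itv/= => /andP[bs ->].
    by rewrite andbT (le_trans (ltW b0)).
  - move=> s h; apply: tail_integrand_ge0 => //; case: h => [/sub//|].
    by rewrite /= in_itv/= => /andP[bs ->]; rewrite andbT (le_trans (ltW b0)).
  - rewrite disj_set2E; apply/eqP/seteqP; split => s //= -[].
    by rewrite !in_itv/= => /andP[_ sb] /andP[bs _]; move: (lt_le_trans sb bs); rewrite ltxx.
  apply: leeD2r.
  apply: (@le_trans _ _
    (\int[leb]_(s in `[a, b[%classic) (2 * K * g / (1 - b))%:E)); last first.
    by rewrite integral_cst//= lebesgue_measure_itv/= lte_fin ab -EFinD -EFinM mulrC.
  apply: ge0_le_integral => //.
  - by move=> s /sub; exact: tail_integrand_ge0.
  - exact: measurable_tail_integrand.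
  - move=> s sab; rewrite lee_fin.
    have /andP[s0 s1] := sub _ sab.
    move: sab; rewrite /= in_itv/= => /andP[as_ sb].
    have W0 : (0 <= w (RtoC s))%R.
      by rewrite -lee_fin; apply/weight_ge0/disc_RtoC => //; rewrite s0.
    apply: (@le_trans _ _ (w (RtoC s))); first by rewrite ler_piMl// ltW.
    rewrite ler_pdivlMr// mulrC.
    apply: (@le_trans _ _ ((1 - s) * w (RtoC s))%R).
      by rewrite ler_wpM2r// lerD2l lerN2 ltW.
    apply: (@le_trans _ _ (2 * K * G s)%R).
      by apply: weight_le_tail; rewrite (le_trans ra)//= s1.
    apply: ler_wpM2l; first by rewrite mulr_ge0// ltW.
    by apply: fine_le; rewrite ?tail_fin//; apply: le_tail => //; exact: ltW.
rewrite (tailE a) (tailE b) -EFinD lee_fin -/g => H.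
suff : ((b - a) * (2 * K * g / (1 - b)) <= g / 2)%R by move: H; lra.
rewrite mulrA ler_pdivrMr//.
have := ler_wpM2r (_ : 0 <= g / 2)%R small; rewrite divr_ge0// => /(_ isT).
by move=> h; apply: le_trans (le_trans h _); [|rewrite mulrC]; lra.
Qed.

(** From 1 - 2 d to 1 - d in N steps of length d / N, each of which loses a factor
    2; the number N of steps depends on K alone. *)
Lemma tail_doubling_small : exists2 B : R, (0 < B)%R &
  forall d : R, (0 < d)%R -> (r0 <= 1 - 2 * d)%R -> (G (1 - 2 * d) <= B * G (1 - d))%R.
Proof.
pose N := (Num.truncn (4 * K)).+1.
have N0 : (0 < N%:R :> R)%R by rewrite ltr0n.
have KN : (4 * K <= N%:R)%R.
  apply: ltW; rewrite /N -truncn_le_nat//.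
exists (2 ^+ N)%R; first by rewrite exprn_gt0.
move=> d d0 rd.
have H i : (i <= N)%N -> (G (1 - 2 * d) <= 2 ^+ i * G (1 - 2 * d + i%:R * (d / N%:R)))%R.
  elim: i => [|i IH] iN; first by rewrite mul0r addr0 expr0 mul1r.
  apply: le_trans (IH (ltnW iN)) _.
  rewrite exprSr -mulrA ler_wpM2l ?exprn_ge0//.
  have h0 : (0 < d / N%:R)%R by rewrite divr_gt0.
  have hi : (0 <= i%:R * (d / N%:R))%R by rewrite mulr_ge0// ltW.
  have hN : (i.+1%:R * (d / N%:R) <= d)%R.
    rewrite mulrA ler_pdivrMr// mulrC; apply: ler_wpM2l; first exact: ltW.
    by rewrite ler_nat.
  move: hN; rewrite -[in X in X -> _]natr1 mulrDl mul1r => hN.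
  have -> : (1 - 2 * d + i.+1%:R * (d / N%:R) = 1 - 2 * d + i%:R * (d / N%:R) + d / N%:R)%R.
    by rewrite -natr1; ring.
  set x := (i%:R * (d / N%:R))%R in hi hN *.
  apply: tail_step.
  - lra.
  - lra.
  - have : (d / N%:R * (4 * K) <= d)%R.
      by rewrite mulrAC ler_pdivrMr//; apply: ler_wpM2l => //; exact: ltW.
    lra.
have := H N (leqnn _); rewrite mulrCA divff ?mulr1 ?gt_eqF//.
by rewrite (_ : 1 - 2 * d + d = 1 - d)%R//; ring.
Qed.

(** When 1 - 2 l is not close to 1, the quotient of the two tails is bounded by
    that of the values at 0 and at a fixed radius. *)
Lemma tail_doubling : exists2 B : R, (0 < B)%R &
  forall l : R, (0 < l)%R -> tail w (1 - 2 * l) <= B%:E * tail w (1 - l).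
Proof.
have [B B0 HB] := tail_doubling_small.
have /andP[r02 r01] := r0_itv.
pose d := ((1 - r0) / 2)%R.
have d0 : (0 < d)%R by rewrite divr_gt0// subr_gt0.
have Gd : (0 < G (1 - d))%R.
  by rewrite -lte_fin -tailE; apply: tail_gt0 => //; rewrite ltrBlDr ltrDl.
have G0 : (0 <= G 0)%R by rewrite fine_ge0// tail_ge0.
exists (B + G 0 / G (1 - d))%R; first by rewrite ltr_wpDr// divr_ge0// ltW.
move=> l l0; rewrite (tailE (1 - 2 * l)) (tailE (1 - l)) -EFinM lee_fin [leRHS]mulrDl.
have Gl : (0 <= G (1 - l))%R by rewrite fine_ge0// tail_ge0.
have [ld|ld] := leP l d.
  have rl : (r0 <= 1 - 2 * l)%R by move: ld; rewrite /d; lra.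
  apply: le_trans (HB _ l0 rl) _.
  by rewrite lerDl mulr_ge0// divr_ge0// ltW.
apply: (@le_trans _ _ (G 0)%R).
  rewrite /tail (_ : radii (1 - 2 * l) = radii (Num.max 0 (1 - 2 * l)))%R; last first.
    apply/seteqP; split => s [/[dup] /andP[s0 s1] s01]; rewrite /radii/= ?ge_max.
      by move=> ->; rewrite ltW.
    by move=> /andP[_ ->].
  by apply: fine_le; rewrite ?tail_fin//; apply: le_tail => //; rewrite le_max lexx.
apply: (@le_trans _ _ (G 0 / G (1 - d) * G (1 - l))%R); last by rewrite lerDr mulr_ge0// ltW.
rewrite mulrAC -mulrA ler_peMr// ler_pdivlMr// mul1r.
by apply: fine_le; rewrite ?tail_fin//; apply: le_tail => //; rewrite lerD2l lerN2 ltW.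
Qed.

End doubling.

(** * Polar boxes and Carleson squares *)
Section polar_boxes.
Context {R : realType}.
Local Notation C := (cplane R).
Implicit Types (J : set R) (rho t th : R) (z : C).

(** A Carleson square whose inner radius is not tied to the length of its arc. It
    contains the origin if rho <= 0 and J is nonempty. *)
Definition polar_box (J : set R) (rho : R) : set C :=
  [set z | exists r t, [/\ z = cpolar r t, J t, 0 <= r & rho <= r < 1]].

Lemma cmod_cpolar r t : cmod (cpolar r t : C) = `|r|.
Proof.
by rewrite /cmod/= !exprMn -mulrDr cos2Dsin2 mulr1 sqrtr_sqr.
Qed.

Lemma rot_cpolar th r t : rot th (cpolar r t) = cpolar r (t + th) :> C.
Proof. by rewrite /rot /cpolar/= sinD cosD; congr pair; ring. Qed.

Lemma rot0 z : rot 0 z = z.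
Proof. by case: z => x y; rewrite /rot cos0 sin0 oppr0 !mul1r !mul0r addr0 add0r. Qed.

Lemma rotK th : cancel (rot th) (rot (- th) : C -> C).
Proof. by move=> z; rewrite rot_rot addNr rot0. Qed.

Lemma cmod_rot th z : cmod (rot th z) = cmod z.
Proof.
rewrite /cmod /rot/=; congr Num.sqrt.
transitivity ((cos th ^+ 2 + sin th ^+ 2) * (z.1 ^+ 2 + z.2 ^+ 2)); first by ring.
by rewrite cos2Dsin2 mul1r.
Qed.

Lemma rot_polar_box th J rho z :
  polar_box J rho z <-> polar_box [set t | J (t - th)] rho (rot th z).
Proof.
split=> [[r [t [-> Jt r0 rr]]]|[r [t [e Jt r0 rr]]]].
  by exists r, (t + th); rewrite rot_cpolar/= addrK.
by exists r, (t - th); split=> //; rewrite -rot_cpolar -e rotK.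
Qed.

Lemma polar_boxS J J' rho rho' : J `<=` J' -> rho' <= rho ->
  polar_box J rho `<=` polar_box J' rho'.
Proof.
move=> JJ rr z [r [t [-> Jt r0 /andP[r1 r2]]]]; exists r, t; split => //; first exact: JJ.
by rewrite r2 (le_trans rr).
Qed.

Lemma polar_boxU J J' rho :
  polar_box (J `|` J') rho = polar_box J rho `|` polar_box J' rho.
Proof.
apply/seteqP; split => [z [r [t [-> [Jt|Jt] r0 rr]]]|].
- by left; exists r, t.
- by right; exists r, t.
- by rewrite subUset; split; apply: polar_boxS.
Qed.

Lemma polar_box_set0 rho : polar_box set0 rho = set0.
Proof. by apply/seteqP; split => // z [r [t []]]. Qed.

Lemma polar_box_disc J rho : polar_box J rho `<=` disc.
Proof.
by move=> z [r [t [-> _ r0 /andP[_ r1]]]]; rewrite /disc/= cmod_cpolar ger0_norm.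
Qed.

Lemma cpolar_period r t (m : int) : cpolar r (t + m%:~R * (2 * pi)) = cpolar r t :> C.
Proof.
have H (n : nat) u : cpolar r (u + n%:R * (2 * pi)) = cpolar r u :> C.
  rewrite /cpolar; have -> : n%:R * (2 * pi) = (pi *+ 2) *+ n :> R.
    by rewrite -[RHS]mulr_natl -[pi *+ 2]mulr_natl.
  by rewrite (periodicn (@cosD2pi R)) (periodicn (@sinD2pi R)).
case: m => n; first exact: H.
rewrite NegzE -[in RHS](subrK (n.+1%:R * (2 * pi)) t) H.
by rewrite mulrNz mulNr.
Qed.

Lemma polar_box_period (J : set R) rho (m : int) :
  polar_box [set t | J (t + m%:~R * (2 * pi))] rho = polar_box J rho.
Proof.
apply/seteqP; split => z [r [t [-> Jt r0 rr]]].
  by exists r, (t + m%:~R * (2 * pi)); rewrite cpolar_period.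
exists r, (t - m%:~R * (2 * pi)); split => //=; last by rewrite subrK.
by rewrite -mulNr -mulrNz cpolar_period.
Qed.

Lemma carleson_squareE (I : interval R) :
  carleson_square I = polar_box [set` I] (1 - arc_length I).
Proof.
apply/seteqP; split => z.
  move=> [r [t [-> r0 [t' It' e] rr]]]; exists r, t'; split => //.
  by move: e; rewrite /cpolar !mul1r => -[-> ->].
move=> [r [t [-> It r0 rr]]]; exists r, t; split => //.
by exists t.
Qed.

Lemma is_arcP (I : interval R) : is_arc I ->
  exists b1 b2 a b, [/\ I = Interval (BSide b1 a) (BSide b2 b), a < b,
     arc_length I = b - a & b - a <= 2 * pi].
Proof.
rewrite /is_arc /arc_length lebesgue_measure_itv.
case: I => -[b1 a|b1] [b2 b|b2] //=; case: ifPn => //; rewrite ?ltxx //=.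
- rewrite lte_fin => ab; rewrite -EFinD lee_fin => /andP[_ ab2].
  by exists b1, b2, a, b.
- by case: b2 => //= _; rewrite andbC leNgt ltry.
- by case: b1 => //= _; rewrite andbC leNgt ltry.
- by case: b1; case: b2 => //= _; rewrite andbC leNgt ltry.
Qed.

(** The origin belongs to polar boxes with rho <= 0 but to no cone. *)
Lemma sectorE M rho z : 0 < M ->
  sector M rho z <-> (polar_box `](- atan M), (atan M)[%classic rho z /\ 0 < cmod z).
Proof.
move=> M0; split.
  move=> [zc rz zd]; have z0 := cone_gt0 _ _ M0 zc; split => //.
  move: zc; rewrite /cone/= => zc.
  have x0 : 0 < z.1 :> R.
    by have := le_lt_trans (normr_ge0 _) zc; rewrite pmulr_rgt0.
  exists (cmod z), (atan (z.2 / z.1)); split.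
  - rewrite /cpolar.
    have -> : cmod z = z.1 * Num.sqrt (1 + (z.2 / z.1) ^+ 2).
      rewrite -[X in X * _](gtr0_norm x0) -sqrtr_sqr -sqrtrM ?sqr_ge0// mulrDr mulr1 -exprMn.
      by rewrite mulrC divfK ?gt_eqF.
    have s0 : 0 < Num.sqrt (1 + (z.2 / z.1) ^+ 2) :> R.
      by rewrite sqrtr_gt0 ltr_pwDl// sqr_ge0.
    have e1 : z.1 * Num.sqrt (1 + (z.2 / z.1) ^+ 2) * cos (atan (z.2 / z.1)) = z.1 :> R.
      by rewrite cos_atan mulfK// gt_eqF.
    have c0 : cos (atan (z.2 / z.1 : R)) != 0.
      by rewrite cos_atan invr_eq0 gt_eqF.
    have e2 : sin (atan (z.2 / z.1)) = z.2 / z.1 * cos (atan (z.2 / z.1)) :> R.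
      by have := atanK (z.2 / z.1 : R); rewrite /tan => {2}<-; rewrite divfK.
    rewrite e2 mulrCA e1 divfK ?gt_eqF//.
    by case: z {zd rz z0 zc x0 s0 c0 e1 e2}.
  - have h : `|z.2 / z.1 : R| < M.
      by rewrite normrM normfV (gtr0_norm x0) ltr_pdivrMr.
    move: h; rewrite ltr_norml => /andP[h1 h2].
    by rewrite /= in_itv/= -atanN !lt_atan.
  - exact: ltW.
  - by rewrite rz.
move=> [[r [t [-> + r0 /andP[rr r1]]]]].
rewrite /= in_itv/= cmod_cpolar ger0_norm// => /andP[t1 t2] rp.
have tpi : - (pi / 2) < t < pi / 2.
  by rewrite (lt_trans _ t1) ?(lt_trans t2) ?atan_ltpi2// ltrN2 atan_ltpi2.
have c0 : 0 < cos t by apply: cos_gt0_pihalf.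
split; rewrite /disc/= ?cmod_cpolar ?ger0_norm//.
rewrite /cone/= normrM gtr0_norm// mulrCA ltr_pM2l//.
have e : sin t = tan t * cos t by rewrite /tan divfK// gt_eqF.
rewrite e normrM (gtr0_norm c0) ltr_pM2r//.
have tt : - (pi / 2) < - atan M < pi / 2.
  by rewrite -atanN atan_gtNpi2 atan_ltpi2.
have tM : - (pi / 2) < atan M < pi / 2 by rewrite atan_gtNpi2 atan_ltpi2.
rewrite ltr_norml -{1 2}(atanK M) -tanN !ltr_tan ?in_itv//= t1 t2//.
Qed.

Lemma measurable_rot_preimage th (A : set C) : measurable A ->
  measurable (rot th @^-1` A).
Proof. by move=> mA; rewrite -[X in measurable X]setTI; exact: measurable_rot. Qed.

Lemma measurable_polar_box1 t rho : measurable (polar_box [set t] rho).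
Proof.
pose A : set C := [set z | ((z.2 : R) = 0)] `&` [set z | 0 <= (z.1 : R)]
  `&` ([set z | rho <= (z.1 : R)] `&` [set z | (z.1 : R) < 1]).
have -> : polar_box [set t] rho = rot (- t) @^-1` A.
  apply/seteqP; split => z.
    move=> [r [_ [-> -> r0 /andP[rr r1]]]]; rewrite /= rot_cpolar subrr /A /cpolar/=.
    by rewrite cos0 sin0 mulr1 mulr0.
  change (A (rot (- t) z) -> polar_box [set t] rho z).
  rewrite -[X in polar_box _ _ X](rotK (- t) z) opprK; move: (rot (- t) z) => y.
  move=> [[/= y2 y1] [/= yr y1']]; exists y.1, t; split => //; last by rewrite yr.
  by rewrite /rot y2 /cpolar; congr pair; ring.
apply: measurable_rot_preimage.
apply: measurableI; apply: measurableI; rewrite -[X in measurable X]setTI.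
- rewrite (_ : [set z : C | _] = [set z : C | (z.2 : R) == 0]); last first.
    by apply/seteqP; split => z /= /eqP.
  by apply: measurable_fun_eqr => //; exact: measurable_snd.
- by apply: measurable_fun_ler => //; exact: measurable_fst.
- by apply: measurable_fun_ler => //; exact: measurable_fst.
- by apply: measurable_fun_ltr => //; exact: measurable_fst.
Qed.

Lemma atan_tan (e : R) : 0 < e <= 1 -> 0 < tan e /\ atan (tan e) = e.
Proof.
move=> /andP[e0 e1].
have pi1 : 1 < pi / 2 :> R.
  rewrite lt_neqAle pihalf_ge1 andbT; apply/eqP => E.
  by have := @cos1_gt0 R; rewrite E cos_pihalf ltxx.
have ee : - (pi / 2) < e < pi / 2.
  by rewrite (le_lt_trans e1)// andbT (lt_trans _ e0)// oppr_lt0 (lt_trans _ pi1).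
split; last by rewrite tanK// in_itv.
by rewrite -tan0 ltr_tan// in_itv//= oppr_lt0 andbb (lt_trans _ pi1).
Qed.

(** A nonzero point of the box lies in a sector centered at a rational angle and
    contained in the box, so the box is a countable union of rotated sectors. The
    radii at the rational angles are added for the sake of the origin. *)
Lemma measurable_polar_boxo (a b rho : R) : measurable (polar_box `]a, b[%classic rho).
Proof.
pose e (q : R) := Num.min (Num.min (q - a) (b - q)) 1.
pose F (q : rat) : set C :=
  if (a < ratr q :> R) && (ratr q < b :> R) then
    polar_box [set ratr q] rho `|` rot (- ratr q) @^-1` sector (tan (e (ratr q))) rho
  else set0.
have -> : polar_box `]a, b[%classic rho = \bigcup_q F q.
  apply/seteqP; split => z.
    move=> [r [t [-> + r0 rr]]]; rewrite /= in_itv/= => /andP[ta tb].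
    (* a rational angle at distance less than d from t is at distance at least
     2 d from the endpoints *)
    pose d := Num.min (Num.min (t - a) (b - t)) 1 / 3.
    have d0 : 0 < d by rewrite divr_gt0// !lt_min !subr_gt0 ta tb ltr01.
    have d1 : d * 3 <= t - a by rewrite divfK// !ge_min lexx.
    have d2 : d * 3 <= b - t by rewrite divfK// !ge_min lexx orbT.
    have d3 : d * 3 <= 1 by rewrite divfK// !ge_min lexx orbT.
    have : t - d < t + d by lra.
    move=> /rat_in_itvoo[q]; rewrite in_itv/= => /andP[q1 q2].
    exists q => //; rewrite /F (_ : _ && _ = true); last by apply/andP; split; lra.
    have e0 : 0 < e (ratr q) <= 1.
      by rewrite /e !lt_min !ge_min lexx orbT andbT; lra.
    have [te at_] := atan_tan _ e0.
    have [rp|rn] := ltP 0 r.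
      right; apply/sectorE => //; rewrite rot_cpolar cmod_cpolar gtr0_norm//; split => //.
      exists r, (t - ratr q); split => //; rewrite at_/= in_itv/= -ltr_norml.
      by rewrite /e !lt_min !ltr_norml; lra.
    left; exists r, (ratr q); split => //.
    by rewrite (_ : r = 0) /cpolar ?mul0r//; apply/eqP; rewrite eq_le rn.
  move=> [q _]; rewrite /F; case: ifPn => // /andP[qa qb] [].
    by move=> [r [_ [-> -> r0 rr]]]; exists r, (ratr q); split => //=; rewrite in_itv/= qa.
  have e0 : 0 < e (ratr q) <= 1.
    by rewrite /e !lt_min !ge_min lexx orbT andbT; lra.
  have [te at_] := atan_tan _ e0.
  move=> /sectorE -/(_ te) [[r [t [E + r0 rr]]] _].
  rewrite at_/= in_itv/= -ltr_norml /e !lt_min !ltr_norml => h.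
  exists r, (t + ratr q); split => //; last by rewrite /= in_itv/=; lra.
  by rewrite -rot_cpolar -E -{1}(opprK (ratr q)) rotK.
apply: bigcupT_measurable_rat => q; rewrite /F; case: ifP => // _.
apply: measurableU; first exact: measurable_polar_box1.
by apply: measurable_rot_preimage; exact: measurable_sector.
Qed.

Lemma measurable_polar_box_itv b1 b2 (a b rho : R) :
  measurable (polar_box [set` Interval (BSide b1 a) (BSide b2 b)] rho).
Proof.
have mset1 (J : set R) c : measurable (polar_box (J `&` [set c]) rho).
  have [Jc|Jc] := pselect (J c).
    by rewrite (_ : _ `&` _ = [set c]) ?setIidr//;
       [exact: measurable_polar_box1|move=> _ ->].
  rewrite (_ : _ `&` _ = set0) ?polar_box_set0//.
  by apply/seteqP; split => // t [+ tc]; rewrite tc.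
set J := [set` _].
rewrite (_ : J = (if a < b then `]a, b[%classic else set0) `|` (J `&` [set a])
    `|` (J `&` [set b])).
  rewrite !polar_boxU; apply: measurableU => //; apply: measurableU => //.
  case: ifP => _; first exact: measurable_polar_boxo.
  by rewrite polar_box_set0.
apply/seteqP; split => t; rewrite /J/=; clear J.
  move=> tJ; have [ta|ta] := eqVneq t a; first by left; right.
  have [tb|tb] := eqVneq t b; first by right; split.
  left; left; move: tJ; rewrite itv_boundlr => /andP[].
  by case: b1; case: b2; rewrite /= !bnd_simp => h1 h2;
    rewrite (_ : a < b) /= ?in_itv/=; lra.
case: ifPn => ab.
  move=> [[|[]//]|[]//]; rewrite /= in_itv/= => /andP[ta tb].
  by rewrite in_itv/=; case: b1; case: b2; rewrite /= ?ta ?tb ?ltW.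
by move=> [[|[]//]|[]//].
Qed.

Lemma measurable_carleson_square (I : interval R) : is_arc I ->
  measurable (carleson_square I).
Proof.
move=> /is_arcP[b1 [b2 [a [b [-> _ _ _]]]]]; rewrite carleson_squareE.
exact: measurable_polar_box_itv.
Qed.

Lemma carleson_square_disc (I : interval R) : carleson_square I `<=` disc.
Proof. by rewrite carleson_squareE; exact: polar_box_disc. Qed.

End polar_boxes.

(** * Weights of Carleson squares *)
Section squares.
Context {R : realType}.
Local Notation C := (cplane R).
Local Notation leb := (@lebesgue_measure R).
Local Notation leb2 := (@lebesgue_measure R \x @lebesgue_measure R)%E.
Variable w : C -> R.
Hypothesis ww : weight w.
Hypothesis rw : radial w.
Local Open Scope ereal_scope.

Lemma wmeas_rot th (A : set C) : measurable A -> A `<=` disc ->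
  wmeas w (rot th @^-1` A) = wmeas w A.
Proof.
move=> mA Ad; rewrite /wmeas.
have mA' := measurable_rot_preimage th _ mA.
have A'd : rot th @^-1` A `<=` disc.
  by move=> z /Ad; rewrite /disc/= cmod_rot.
have mw (B : set C) : measurable B -> B `<=` disc ->
    measurable_fun B (fun z => (w z)%:E).
  by move=> mB Bd; exact: measurable_funS measurable_disc Bd (weight_measurable _ ww).
rewrite !integral_areaA//; last 4 first.
- exact: mw.
- by move=> z /Ad; exact: weight_ge0.
- exact: mw.
- by move=> z /A'd; exact: weight_ge0.
congr (_ * _); pose F := (fun z => (w z)%:E) \_ A.
rewrite integral_mkcond [RHS]integral_mkcond -/F -(integral_rot th F).
- apply: eq_integral => z _; rewrite /F !patchE.
  have -> : (z \in rot th @^-1` A) = (rot th z \in A).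
    by apply/idP/idP; rewrite !inE.
  case: ifPn => // /[!inE] /Ad; rewrite {1}/disc/= => zd.
  by rewrite (rw (rot th z))// cmod_rot -rw// /disc/= -(cmod_rot th).
- by apply/(measurable_restrictT _ mA); exact: mw.
- by move=> z; apply: erestrict_ge0 => {}z /Ad; exact: weight_ge0.
Qed.

Lemma areaA_origin : areaA [set (0%R, 0%R) : C] = 0.
Proof.
rewrite /areaA /=.
transitivity (((pi : R)^-1)%:E * leb2 ([set (0%R : R)] `*` [set (0%R : R)])).
  congr (_ * _); congr leb2; apply/seteqP; split => [_ ->//|[x y] [/= -> ->]//].
transitivity (((pi : R)^-1)%:E * (leb [set 0%R] * leb [set 0%R])).
  by congr (_ * _); exact: product_measure1E.
by rewrite lebesgue_measure_set1 mule0 mule0.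
Qed.

Lemma measurable_origin : measurable [set (0%R, 0%R) : C].
Proof.
rewrite (_ : [set _] = [set 0%R : measurableTypeR R] `*` [set 0%R : measurableTypeR R]).
  exact: measurableX.
by apply/seteqP; split => [_ ->//|[x y] [/= -> ->]//].
Qed.

Lemma cmod_eq0 (z : C) : (cmod z <= 0)%R -> z = (0%R, 0%R).
Proof.
case: z => x y; rewrite /cmod/= leNgt sqrtr_gt0 -leNgt => h.
have x0 : (x ^+ 2 = 0)%R.
  by apply/eqP; rewrite eq_le sqr_ge0 andbT; apply: le_trans h; rewrite lerDl sqr_ge0.
have y0 : (y ^+ 2 = 0)%R.
  by apply/eqP; rewrite eq_le sqr_ge0 andbT; apply: le_trans h; rewrite lerDr sqr_ge0.
by move/eqP: x0; move/eqP: y0; rewrite !sqrf_eq0 => /eqP -> /eqP ->.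
Qed.

(** Squares of side at least 1 all share the origin, and sectors miss it. Being a
    null set, it may be ignored in coverings and in disjoint unions alike. *)
Lemma le_integral_origin (A B : set C) (f : C -> \bar R) :
  measurable A -> measurable B -> measurable_fun A f -> measurable_fun B f ->
  (forall z, A z -> 0 <= f z) -> (forall z, B z -> 0 <= f z) ->
  A `<=` B `|` [set (0%R, 0%R)] ->
  \int[areaA]_(z in A) f z <= \int[areaA]_(z in B) f z.
Proof.
move=> mA mB mfA mfB fA fB AB.
have mO := measurable_origin.
rewrite (@ge0_negligible_integral _ _ _ areaA A [set (0%R, 0%R)])//; last exact: areaA_origin.
apply: ge0_subset_integral => //; first exact: measurableD.
by move=> z [Az z0]; case: (AB _ Az).
Qed.

Lemma integral_setU_origin (A B D : set C) (f : C -> \bar R) :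
  measurable A -> measurable B -> measurable D -> measurable_fun D f ->
  (forall z, D z -> 0 <= f z) -> A `<=` D -> B `<=` D ->
  A `&` B `<=` [set (0%R, 0%R)] ->
  \int[areaA]_(z in A) f z + \int[areaA]_(z in B) f z <=
  \int[areaA]_(z in D) f z.
Proof.
move=> mA mB mD mf f0 AD BD AB.
have mBA : measurable (B `\` A) by exact: measurableD.
have BAD : B `\` A `<=` D by move=> z [/BD].
apply: (@le_trans _ _ (\int[areaA]_(z in A) f z + \int[areaA]_(z in B `\` A) f z)).
  apply: leeD2l; apply: le_integral_origin => //.
  - exact: measurable_funS mf.
  - exact: measurable_funS mf.
  - by move=> z /BD /f0.
  - by move=> z /BAD /f0.
  - move=> z Bz; have [Az|nAz] := pselect (A z); first by right; apply: AB.
    by left.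
have ABD : A `|` B `\` A `<=` D by rewrite subUset.
rewrite -ge0_integral_setU//.
- apply: ge0_subset_integral => //; exact: measurableU.
- by apply: measurable_funS mf.
- by move=> z /ABD /f0.
- by rewrite disj_set2E setDIK.
Qed.

Lemma le_integral_setU (A B : set C) (f : C -> \bar R) :
  measurable A -> measurable B -> measurable_fun (A `|` B) f ->
  (forall z, (A `|` B) z -> 0 <= f z) ->
  \int[areaA]_(z in A `|` B) f z <=
  \int[areaA]_(z in A) f z + \int[areaA]_(z in B) f z.
Proof.
move=> mA mB mf f0.
have mBA : measurable (B `\` A) by exact: measurableD.
have E : A `|` B = A `|` (B `\` A).
  apply/seteqP; split => z; last by case=> [|[]]; [left|right].
  by case=> [|Bz]; [left|have [Az|nAz] := pselect (A z); [left|right]].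
rewrite E ge0_integral_setU// -?E//.
  apply: leeD2l; apply: ge0_subset_integral => //.
  - exact: measurable_funS (measurableU _ _ mA mB) (@subsetUr _ _ _) mf.
  - by move=> z Bz; apply: f0; right.
by rewrite disj_set2E setDIK.
Qed.

Lemma measurable_weight (A : set C) : measurable A -> A `<=` disc ->
  measurable_fun A (fun z => (w z)%:E).
Proof.
by move=> mA Ad; exact: measurable_funS measurable_disc Ad (weight_measurable _ ww).
Qed.

(** Up to the origin, an interval of length n e is covered by n rotated copies of
    the interval (-e, e), and rotations preserve a radial weight. *)
Lemma wmeas_box_le n (a e rho : R) : (0 < e <= 1)%R ->
  wmeas w (polar_box `[a, (a + n%:R * e)%R[%classic rho) <=
  n%:R%:E * wmeas w (sector (tan e) rho).
Proof.
move=> e01; have [te at_] := atan_tan _ e01; case/andP: (e01) => e0 e1.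
have sd : sector (tan e) rho `<=` disc by move=> z [].
elim: n => [|n IH].
  rewrite mul0r addr0 mul0e set_itvE polar_box_set0 /wmeas.
  by rewrite integral_set0.
set c := (a + n%:R * e)%R in IH *.
have h0 : (0 <= n%:R * e)%R by rewrite mulr_ge0// ltW.
have -> : (a + n.+1%:R * e = c + e)%R by rewrite -natr1 mulrDl mul1r addrA.
have -> : `[a, (c + e)%R[%classic = `[a, c[%classic `|` `[c, (c + e)%R[%classic :> set R.
  by apply/seteqP; split => s; rewrite /= !in_itv/= /c; lra.
have m1 := measurable_polar_box_itv true true a c rho.
have m2 := measurable_polar_box_itv true true c (c + e) rho.
rewrite polar_boxU; apply: le_trans (le_integral_setU _ _ _ m1 m2 _ _) _.
- apply: measurable_weight; first exact: measurableU.
  by rewrite subUset; split; exact: polar_box_disc.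
- by move=> z [] /polar_box_disc; exact: weight_ge0.
rewrite -natr1 EFinD ge0_muleDl ?lee_fin//.
apply: leeD; first exact: IH.
rewrite mul1e -[leRHS](wmeas_rot (- c))//; last exact: measurable_sector.
apply: le_integral_origin => //.
- by apply: measurable_rot_preimage; exact: measurable_sector.
- by apply: measurable_weight => //; exact: polar_box_disc.
- apply: measurable_weight; first by apply: measurable_rot_preimage; exact: measurable_sector.
  by move=> z /sd; rewrite /disc/= cmod_rot.
- by move=> z /polar_box_disc; exact: weight_ge0.
- by move=> z /sd; rewrite /disc/= cmod_rot => zd; exact: weight_ge0.
- move=> z [r [t [-> + r0 rr]]]; rewrite /= in_itv/= => /andP[ct tc].
  have [rp|rn] := ltP 0%R r; last first.
    by right; apply: cmod_eq0; rewrite cmod_cpolar ger0_norm.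
  left; apply/sectorE => //; rewrite rot_cpolar cmod_cpolar gtr0_norm//; split => //.
  by exists r, (t - c)%R; split => //; rewrite at_/= in_itv/=; lra.
Qed.

Lemma arc_length_gt0 (I : interval R) : is_arc I -> (0 < arc_length I)%R.
Proof. by move=> /is_arcP[b1 [b2 [a [b [_ ab -> _]]]]]; rewrite subr_gt0. Qed.

Lemma arc_length_le8 (I : interval R) : is_arc I -> (0 < arc_length I / 8 <= 1)%R.
Proof.
move=> aI; rewrite divr_gt0 ?arc_length_gt0//= ler_pdivrMr// mul1r.
have := @pihalf_lt2 R; have [b1 [b2 [a [b [_ ab -> ]]]]] := is_arcP _ aI; lra.
Qed.

(** The sector of half-opening |I| / 8, rotated to the midpoint of I, lies in the
    square over I; its opening is below pi, so it is part of a cone even when I is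
    the whole circle. *)
Lemma le_sector_carleson (I : interval R) : is_arc I ->
  wmeas w (sector (tan (arc_length I / 8)) (1 - arc_length I)) <=
  wmeas w (carleson_square I).
Proof.
move=> aI; have e01 := arc_length_le8 _ aI; have [te at_] := atan_tan _ e01.
have mI := measurable_carleson_square _ aI; have Id := @carleson_square_disc _ I.
have [b1 [b2 [a [b [IE ab Il lpi]]]]] := is_arcP _ aI.
set M := tan _; set rho := (1 - _)%R.
have sd : sector M rho `<=` disc by move=> z [].
pose c := ((a + b) / 2)%R.
rewrite -(wmeas_rot (- c))//; last exact: measurable_sector.
apply: le_wmeas => //; first by apply: measurable_rot_preimage; exact: measurable_sector.
rewrite carleson_squareE -/rho => z /sectorE-/(_ te)[+ _].
move=> [r [t [E + r0 rr]]]; rewrite at_ /= in_itv/= => h.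
exists r, (t + c)%R; split => //; last first.
  rewrite /= IE itv_boundlr; move: h; rewrite Il /c.
  by case: (b1); case: (b2); rewrite /= !bnd_simp; lra.
by rewrite -rot_cpolar -E -{1}(opprK c) rotK.
Qed.

Lemma wmeas_carleson_gt0 (I : interval R) : is_arc I -> 0 < wmeas w (carleson_square I).
Proof.
move=> aI; apply: lt_le_trans (le_sector_carleson _ aI).
have [te _] := atan_tan _ (arc_length_le8 _ aI).
rewrite wmeas_sector// mule_gt0//.
  by rewrite lte_fin mulr_gt0 ?invr_gt0 ?pi_gt0 ?cone_aperture_gt0.
by apply: tail_gt0 => //; rewrite ltrBlDr ltrDl arc_length_gt0.
Qed.

Lemma wmeas_fin (A : set C) : measurable A -> A `<=` disc -> wmeas w A \is a fin_num.
Proof.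
move=> mA Ad; rewrite ge0_fin_numE ?wmeas_ge0//.
by apply: le_lt_trans (wmeas_disc_fin _ ww); apply: le_wmeas => //; exact: measurable_disc.
Qed.

(** Both squares are compared with the sector of half-opening |I| / 8: sixteen
    rotated copies of it cover the box over an interval of length at most 2 |I|,
    one copy is contained in the square over I, and the difference of the depths is
    absorbed by the doubling of the tail. By rotation invariance the two intervals
    need not be related in position. *)
Lemma carleson_doubling (B : R) : (0 < B)%R ->
  (forall l, (0 < l)%R -> tail w (1 - 2 * l) <= B%:E * tail w (1 - l)) ->
  forall (I : interval R) (a L : R), is_arc I ->
  (arc_length I <= L <= 2 * arc_length I)%R ->
  wmeas w (polar_box `[a, (a + L)%R[%classic (1 - L)) <=
  (16 * B)%:E * wmeas w (carleson_square I).
Proof.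
move=> B0 HB I a L aI /andP[lL Ll].
have e01 := arc_length_le8 _ aI; have [te at_] := atan_tan _ e01.
have l0 := arc_length_gt0 _ aI; set l := arc_length I in e01 te at_ lL Ll l0 *.
apply: (@le_trans _ _ (wmeas w (polar_box `[a, (a + 16%:R * (l / 8))%R[%classic (1 - 2 * l)))).
  apply: le_wmeas => //; try exact: measurable_polar_box_itv; last exact: polar_box_disc.
  apply: polar_boxS; last lra.
  by move=> s; rewrite /= !in_itv/=; lra.
apply: le_trans (wmeas_box_le _ _ _ _ e01) _.
rewrite EFinM -muleA; apply: lee_wpmul2l; first by rewrite lee_fin.
have p0 : (0 <= pi^-1 * cone_aperture (tan (l / 8)))%R.
  by rewrite mulr_ge0 ?invr_ge0 ?pi_ge0// ltW// cone_aperture_gt0.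
rewrite wmeas_sector//.
apply: (@le_trans _ _ (B%:E * wmeas w (sector (tan (l / 8)) (1 - l)))).
  by rewrite wmeas_sector// muleCA; apply: lee_wpmul2l => //; exact: HB.
by apply: lee_wpmul2l; [rewrite lee_fin ltW|exact: le_sector_carleson].
Qed.

End squares.

(** * Powers *)
Section powers.
Context {R : realType}.

(** x ^ e = x * x ^ (e - 1), and the second factor increases with x. *)
Lemma powR_superadditive (e a b : R) : 1 <= e -> 0 <= a -> 0 <= b ->
  a `^ e + b `^ e <= (a + b) `^ e.
Proof.
move=> e1 a0 b0.
have H (x : R) : 0 <= x -> x `^ e = x * x `^ (e - 1).
  move=> x0; rewrite -{2}(powRr1 x0) -powRD ?subrKC//.
  by apply/implyP => /eqP e0; move: e1; rewrite e0; lra.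
have M (x y : R) : 0 <= x -> 0 <= y -> x * x `^ (e - 1) <= x * (x + y) `^ (e - 1).
  move=> x0 y0; apply: ler_wpM2l => //.
  by apply: ge0_ler_powR; rewrite ?nnegrE ?subr_ge0 ?lerDl//; exact: addr_ge0.
rewrite !H ?addr_ge0// mulrDl; apply: lerD; first exact: M.
by rewrite (addrC a b); exact: M.
Qed.

Local Open Scope ereal_scope.

Lemma poweR_superadditive (e : R) (a b : \bar R) : (1 <= e)%R -> 0 <= a -> 0 <= b ->
  a `^ e + b `^ e <= (a + b) `^ e.
Proof.
move=> e1; have e0 : (e != 0)%R by apply/eqP => E; move: e1; rewrite E; lra.
case: a => [a| |]//; case: b => [b| |]//; rewrite ?lee_fin => a0 b0.
- exact: powR_superadditive.
- by rewrite addey// (poweRyr e0) leey.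
- by rewrite addye// (poweRyr e0) leey.
- by rewrite addye// (poweRyr e0) leey.
Qed.

Lemma le_poweR (e : R) (a b : \bar R) : (0 <= e)%R -> 0 <= a -> a <= b ->
  a `^ e <= b `^ e.
Proof.
move=> e0 a0 ab; apply: gt0_ler_poweR => //; rewrite in_itv/= ?a0 ?leey//.
by rewrite (le_trans a0).
Qed.

End powers.

(** * Dyadic squares *)
Section dyadic.
Context {R : realType}.
Local Notation C := (cplane R).

Definition dyadic_length (k : nat) : R := 2 * pi / 2 ^+ k.

Lemma dyadic_length_gt0 k : 0 < dyadic_length k.
Proof. by rewrite divr_gt0 ?exprn_gt0 ?mulr_gt0 ?pi_gt0. Qed.

Lemma dyadic_lengthD k i : dyadic_length k = (2 ^ i)%:R * dyadic_length (k + i).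
Proof.
rewrite /dyadic_length exprD natrX; field.
by rewrite !expf_neq0.
Qed.

Definition half_open_square (a L : R) : set C := polar_box `[a, a + L[%classic (1 - L).

Definition dyadic_square k j := half_open_square (j%:R * dyadic_length k) (dyadic_length k).

(** A dyadic square with its two neighbours. An arc is covered by two adjacent
    dyadic intervals, and enlarging either of them in this way recovers the arc. *)
Definition dyadic_square3 k j : set C :=
  polar_box `[(j%:R - 1) * dyadic_length k, (j%:R + 2) * dyadic_length k[%classic
    (1 - dyadic_length k).

Lemma half_open_squareE (a L : R) : 0 < L ->
  half_open_square a L = carleson_square `[a, a + L[.
Proof.
move=> L0; rewrite carleson_squareE /arc_length lebesgue_measure_itv/= lte_fin ltrDl L0.
by rewrite -EFinD/= addrAC subrr add0r.
Qed.

Lemma is_arc_half_open (a L : R) : 0 < L <= 2 * pi -> is_arc `[a, a + L[.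
Proof.
move=> /andP[L0 Lpi]; rewrite /is_arc lebesgue_measure_itv/= lte_fin ltrDl L0.
by rewrite -EFinD/= addrAC subrr add0r lte_fin L0 lee_fin.
Qed.

Lemma dyadic_length_le k : dyadic_length k <= 2 * pi.
Proof.
rewrite ler_pdivrMr ?exprn_gt0// ler_peMr ?mulr_ge0 ?pi_ge0//.
by rewrite exprn_ege1// ler1n.
Qed.

Lemma measurable_dyadic_square k j : measurable (dyadic_square k j).
Proof. exact: measurable_polar_box_itv. Qed.

Lemma measurable_dyadic_square3 k j : measurable (dyadic_square3 k j).
Proof. exact: measurable_polar_box_itv. Qed.

Lemma dyadic_square3_nested k i j j' : (j * 2 ^ i <= j' < j.+1 * 2 ^ i)%N ->
  dyadic_square3 (k + i) j' `<=` dyadic_square3 k j.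
Proof.
move=> /andP[j1 j2]; rewrite /dyadic_square3 (dyadic_lengthD k i).
have L0 := dyadic_length_gt0 (k + i); set L := dyadic_length (k + i) in L0 *.
have i1 : 1 <= (2 ^ i)%:R :> R by rewrite ler1n expn_gt0.
have j1' : j%:R * (2 ^ i)%:R <= j'%:R :> R by rewrite -natrM ler_nat.
have j2' : j'%:R + 1 <= (j%:R + 1) * (2 ^ i)%:R :> R.
  by rewrite !natr1 -natrM ler_nat.
set T := (2 ^ i)%:R in i1 j1' j2' *.
apply: polar_boxS => [t|]; last by rewrite lerD2l lerN2 ler_peMl// ltW.
rewrite /= !in_itv/= => /andP[t1 t2]; apply/andP; split.
  apply: le_trans t1; rewrite mulrA; apply: ler_wpM2r; first exact: ltW.
  by rewrite mulrBl mul1r; lra.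
apply: lt_le_trans t2 _; rewrite mulrA; apply: ler_wpM2r; first exact: ltW.
by rewrite mulrDl; move: j2'; rewrite mulrDl mul1r; lra.
Qed.

Lemma cpolar_inj (r r' t t' : R) : 0 < r -> 0 <= r' -> `|t - t'| < 2 * pi ->
  cpolar r t = cpolar r' t' :> C -> t = t'.
Proof.
move=> r0 r'0 tt E.
have rr : r = r'.
  by move: (congr1 cmod E); rewrite !cmod_cpolar ger0_norm ?ltW// ger0_norm.
move: E; rewrite /cpolar -rr => -[/(mulfI (lt0r_neq0 r0)) ec /(mulfI (lt0r_neq0 r0)) es].
have c1 : cos (t - t') = 1 by rewrite cosB ec es -!expr2 cos2Dsin2.
have s0 : sin (`|t - t'| / 2) = 0.
  apply/eqP; rewrite -sqrf_eq0; apply/eqP.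
  have : cos (`|t - t'|) = 1 by rewrite cos_norm.
  rewrite {1}(splitr `|t - t'|) cosD -!expr2 cos2sin2; lra.
apply/eqP; rewrite -subr_eq0 -normr_eq0; apply/eqP.
have n0 := normr_ge0 (t - t').
have [//|n1] : `|t - t'| = 0 \/ 0 < `|t - t'|.
  by move: n0; rewrite le_eqVlt => /orP[/eqP|]; [left|right].
have : 0 < `|t - t'| / 2 < pi by rewrite divr_gt0//= ltr_pdivrMr// mulrC.
by move=> /sin_gt0_pi; rewrite s0 ltxx.
Qed.

Lemma polar_box_disjoint (a b c rho : R) : c - a <= 2 * pi -> a <= b -> b <= c ->
  polar_box `[a, b[%classic rho `&` polar_box `[b, c[%classic rho `<=`
  [set (0, 0) : C].
Proof.
move=> ca ab bc z [[r [t [-> + r0 rr]]] [r' [t' [E + r'0 rr']]]].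
rewrite /= !in_itv/= => /andP[t1 t2] /andP[t'1 t'2].
have [rp|rn] := ltP 0 r; last first.
  by have -> : r = 0 by [apply/eqP; rewrite eq_le rn]; rewrite /cpolar !mul0r.
have : t = t' by apply: (cpolar_inj _ _ _ _ rp r'0) E; rewrite ltr_norml; lra.
by move=> tt; move: (lt_le_trans t2 t'1); rewrite tt ltxx.
Qed.

Lemma dyadic_length_half k : dyadic_length k = 2 * dyadic_length k.+1.
Proof. by rewrite (dyadic_lengthD k 1) addn1 expn1. Qed.

Lemma dyadic_child_l k j : dyadic_square k.+1 j.*2 `<=` dyadic_square k j.
Proof.
have L0 := dyadic_length_gt0 k.+1.
apply: polar_boxS => [t|]; rewrite (dyadic_length_half k); last by lra.
by rewrite /= !in_itv/= -mul2n natrM => /andP[t1 t2]; lra.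
Qed.

Lemma dyadic_child_r k j : dyadic_square k.+1 j.*2.+1 `<=` dyadic_square k j.
Proof.
have L0 := dyadic_length_gt0 k.+1.
apply: polar_boxS => [t|]; rewrite (dyadic_length_half k); last by lra.
by rewrite /= !in_itv/= -mul2n -natr1 natrM => /andP[t1 t2]; lra.
Qed.

Lemma dyadic_children_disjoint k j :
  dyadic_square k.+1 j.*2 `&` dyadic_square k.+1 j.*2.+1 `<=` [set (0, 0) : C].
Proof.
have L0 := dyadic_length_gt0 k.+1.
have Lk : 2 * dyadic_length k.+1 <= 2 * pi.
  by rewrite -dyadic_length_half dyadic_length_le.
rewrite /dyadic_square /half_open_square -natr1 mulrDl mul1r.
by apply: polar_box_disjoint; lra.
Qed.

(** The Calderon-Zygmund selection, searched n generations deep below the square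
    (k, j): the union of the enlargements of the maximal squares that satisfy D.
    The recursion on the tree never names these maximal squares, and turns the
    estimate of the measure of their union into an induction. *)
Fixpoint stopped (D : nat -> nat -> bool) n k j : set C :=
  if D k j then dyadic_square3 k j else
  if n is n'.+1 then stopped D n' k.+1 j.*2 `|` stopped D n' k.+1 j.*2.+1 else set0.

Lemma measurable_stopped D n k j : measurable (stopped D n k j).
Proof.
elim: n k j => [|n IH] k j /=; case: ifP => _ //; try exact: measurable_dyadic_square3.
exact: measurableU.
Qed.

Lemma stoppedS D n k j : stopped D n.+1 k j =
  if D k j then dyadic_square3 k j
  else stopped D n k.+1 j.*2 `|` stopped D n k.+1 j.*2.+1.
Proof. by []. Qed.

Lemma stopped_mono D n k j : stopped D n k j `<=` stopped D n.+1 k j.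
Proof.
elim: n k j => [|n IH] k j; first by rewrite stoppedS [X in X `<=` _]/=; case: (D k j) => //.
rewrite (stoppedS D n) (stoppedS D n.+1); case: (D k j) => //.
by apply: setUSS; exact: IH.
Qed.

(** Stopping at a square loses nothing, because its enlargement contains those of
    all the dyadic squares below it. *)
Lemma stopped_cover (D : nat -> nat -> bool) i n k j j' : (i <= n)%N ->
  (j * 2 ^ i <= j' < j.+1 * 2 ^ i)%N -> D (k + i)%N j' ->
  dyadic_square3 (k + i) j' `<=` stopped D n k j.
Proof.
elim: i n k j => [|i IH] n k j ni jj Dj'.
  have -> : stopped D n k j = if D k j then dyadic_square3 k j else
     stopped D n k j by case: n {ni} => [|n] /=; case: ifP.
  move: jj; rewrite expn0 !muln1 ltnS -eqn_leq => /eqP ->.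
  by move: Dj'; rewrite addn0 => ->.
case: n ni => // n ni /=; case: ifPn => DD; first exact: dyadic_square3_nested.
move: Dj'; rewrite addnS -addSn => Dj'.
move: jj; rewrite expnS mulnA muln2 mulnA muln2 doubleS => /andP[j1 j2].
have [jm|jm] := ltnP j' (j.*2.+1 * 2 ^ i).
  by apply: subset_trans (@subsetUl _ _ _); apply: IH => //; rewrite j1.
by apply: subset_trans (@subsetUr _ _ _); apply: IH => //; rewrite jm.
Qed.

End dyadic.

(** * Arcs and dyadic intervals *)
Section locating_arcs.
Context {R : realType}.
Local Notation C := (cplane R).

Lemma dyadic_scale (l : R) : 0 < l <= 2 * pi ->
  exists k, l <= dyadic_length k <= 2 * l.
Proof.
move=> /andP[l0 lpi].
have ex : exists k, 2 * pi / 2 ^+ k.+1 < l :> R.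
  exists (Num.truncn (2 * pi / l)).
  rewrite ltr_pdivrMr ?exprn_gt0// [ltRHS]mulrC -ltr_pdivrMr//.
  have lt2 n : n%:R < 2 ^+ n :> R by rewrite -natrX ltr_nat ltn_expl.
  exact: lt_trans (truncnS_gt _) (lt2 _).
have [k Pk mink] := find_ex_minn ex.
exists k; apply/andP; split; last first.
  by rewrite dyadic_length_half; move: Pk; rewrite -/(dyadic_length k.+1); lra.
case: k {Pk} mink => [|k] mink; first by rewrite /dyadic_length expr0 divr1.
by rewrite leNgt; apply/negP => /mink; rewrite ltnn.
Qed.

(** A translation by a multiple of 2 pi brings the left endpoint of I into
    [0, 2 pi); an interval no longer than the dyadic ones of its scale then meets
    at most two of them, the one that contains its left endpoint and the next. *)
Lemma arc_in_dyadic (I : interval R) : is_arc I ->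
  exists k j, [/\ (j < 2 ^ k)%N,
    arc_length I <= dyadic_length k <= 2 * arc_length I &
    carleson_square I `<=`
      polar_box (`[j%:R * dyadic_length k, (j%:R + 2) * dyadic_length k[%classic : set R)
        (1 - dyadic_length k)].
Proof.
move=> aI; have [b1 [b2 [a [b [IE ab Il lpi]]]]] := is_arcP _ aI.
set l := arc_length I in Il *.
have l0 : 0 < l by exact: arc_length_gt0.
have [k /andP[lk kl]] : exists k, l <= dyadic_length k <= 2 * l.
  by apply: dyadic_scale; rewrite l0 Il.
have L0 := dyadic_length_gt0 k (R := R); set L := dyadic_length k in lk kl L0 *.
have pi2 : 0 < 2 * pi :> R by rewrite mulr_gt0// pi_gt0.
pose m := Num.floor (a / (2 * pi)).
have /andP[m1 m2] := floor_itv (a / (2 * pi)).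
rewrite -/m in m1 m2.
move: m1 m2; rewrite ler_pdivlMr// ltr_pdivrMr// => m1 m2.
pose a' := a - m%:~R * (2 * pi).
have a'0 : 0 <= a' by rewrite subr_ge0.
have a'pi : a' < 2 * pi.
  by rewrite ltrBlDr; move: m2; rewrite rmorphD/= mulrDl mul1r addrC.
pose j := Num.truncn (a' / L).
have a'L : 0 <= a' / L := divr_ge0 a'0 (ltW L0).
have /andP[j1 j2] := truncn_itv a'L.
move: j1 j2; rewrite -/j ler_pdivlMr// ltr_pdivrMr// => j1 j2.
exists k, j; split; [|by rewrite lk|].
  have : j%:R * L < (2 ^ k)%:R * L.
    apply: le_lt_trans j1 _; apply: lt_le_trans a'pi _.
    by rewrite natrX /L /dyadic_length [leRHS]mulrC divfK ?expf_neq0.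
  by rewrite ltr_pM2r// ltr_nat.
rewrite carleson_squareE -/l -(polar_box_period _ _ m).
apply: polar_boxS; last by rewrite lerD2l lerN2.
move=> t /= tI; have /andP[t1 t2] : a <= t + m%:~R * (2 * pi) <= b.
  move: tI; rewrite /= IE itv_boundlr => /andP[].
  by case: (b1); case: (b2); rewrite /= !bnd_simp; lra.
rewrite in_itv/= -/L mulrDl.
move: j2; rewrite -natr1 (mulrDl j%:R) mul1r => j2.
move: j1 j2; rewrite /a' => j1 j2; apply/andP; split; lra.
Qed.

End locating_arcs.

(** * The weak-type estimate *)
Section weak_type.
Context {R : realType}.
Local Notation C := (cplane R).
Local Open Scope ereal_scope.
Variable w : C -> R.
Hypothesis ww : weight w.
Hypothesis rw : radial w.
Variable mu : {measure set C -> \bar R}.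
Variables (e K : R).
Hypothesis e1 : (1 <= e)%R.
Hypothesis K0 : (0 <= K)%R.
Hypothesis muK : forall I, is_arc I ->
  mu (carleson_square I) <= K%:E * (wmeas w (carleson_square I)) `^ e.

Lemma carleson_half_open (a L : R) : (0 < L <= 2 * pi)%R ->
  mu (half_open_square a L) <= K%:E * (wmeas w (half_open_square a L)) `^ e.
Proof.
move=> Lpi; have /andP[L0 _] := Lpi.
by rewrite half_open_squareE//; apply: muK; exact: is_arc_half_open.
Qed.

Lemma wmeas_half_open (a b L : R) :
  wmeas w (half_open_square a L) = wmeas w (half_open_square b L).
Proof.
rewrite -[RHS](wmeas_rot _ ww rw (b - a)); last 2 first.
- exact: measurable_polar_box_itv.
- exact: polar_box_disc.
congr wmeas; apply/seteqP; split => z.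
  move=> /(rot_polar_box (b - a)); apply: polar_boxS => // t /=.
  by rewrite !in_itv/=; lra.
move=> h; apply/(rot_polar_box (b - a)); move: h; apply: polar_boxS => // t /=.
by rewrite !in_itv/=; lra.
Qed.

(** The three squares are rotations of one another, hence of equal weight. *)
Lemma mu_dyadic_square3 k j :
  mu (dyadic_square3 k j) <= (3 * K)%:E * (wmeas w (dyadic_square k j)) `^ e.
Proof.
have L0 := dyadic_length_gt0 k (R := R); set L := dyadic_length k in L0 *.
have Lpi : (0 < L <= 2 * pi)%R by rewrite L0 dyadic_length_le.
pose H (i : R) := half_open_square (i * L)%R L : set C.
have mH i : measurable (H i) by exact: measurable_polar_box_itv.
have muH i : mu (H i) <= K%:E * (wmeas w (dyadic_square k j)) `^ e.
  rewrite /dyadic_square (wmeas_half_open _ (i * L)).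
  exact: carleson_half_open.
apply: (@le_trans _ _ (mu (H (j%:R - 1)%R `|` (H j%:R `|` H (j%:R + 1)%R)))).
  apply: le_measure; rewrite ?inE.
  - exact: measurable_dyadic_square3.
  - by apply: measurableU => //; exact: measurableU.
  - rewrite /H /half_open_square -!polar_boxU; apply: polar_boxS => // t.
    rewrite /= !in_itv/=  -/L => /andP[]; set x := j%:R.
    rewrite !mulrDl mulNr mul1r => t1 t2.
    have [h|h] := ltP t (x * L)%R; first by left; lra.
    have [h'|h'] := ltP t (x * L + L)%R; first by right; left; lra.
    by right; right; lra.
apply: (@le_trans _ _ (mu (H (j%:R - 1)%R) + (mu (H j%:R) + mu (H (j%:R + 1)%R)))).
  apply: le_trans (measureU2 _ _ _) _ => //; first exact: measurableU.
  by apply: leeD2l; exact: measureU2.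
have -> : ((3 * K)%:E = K%:E + (K%:E + K%:E)).
  by rewrite -!EFinD; congr EFin; ring.
rewrite !ge0_muleDl ?lee_fin ?addr_ge0//.
by apply: leeD => //; exact: leeD.
Qed.

Variable u : C -> \bar R.
Hypothesis u0 : forall z, disc z -> 0 <= u z.
Hypothesis mu_u : measurable_fun disc u.
Variable eta : R.
Hypothesis eta0 : (0 < eta)%R.

Local Notation U A := (\int[areaA]_(z in A) u z).

Definition heavy k j : bool :=
  eta%:E * wmeas w (dyadic_square k j) < U (dyadic_square k j).

Lemma measurable_u (A : set C) : measurable A -> A `<=` disc -> measurable_fun A u.
Proof. by move=> mA Ad; exact: measurable_funS measurable_disc Ad mu_u. Qed.

Lemma U_ge0 (A : set C) : A `<=` disc -> 0 <= U A.
Proof. by move=> Ad; apply: integral_ge0 => z /Ad; exact: u0. Qed.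

Lemma le_U (A B : set C) : measurable A -> measurable B -> A `<=` B -> B `<=` disc ->
  U A <= U B.
Proof.
move=> mA mB AB Bd; apply: ge0_subset_integral => //; first exact: measurable_u.
by move=> z /Bd; exact: u0.
Qed.

(** At a heavy square the Carleson condition applies, and its weight is at most the
    integral of u over it divided by eta. Otherwise the bounds for the two halves
    add up, by superadditivity of x ^ e; this is where q >= p enters, as e = q / p. *)
Lemma mu_stopped n k j :
  mu (stopped heavy n k j) <= (3 * K)%:E * ((eta^-1)%:E * U (dyadic_square k j)) `^ e.
Proof.
have e0 : (0 <= e)%R by apply: le_trans e1.
have K3 : 0 <= (3 * K)%:E by rewrite lee_fin mulr_ge0.
have eta'0 : 0 <= (eta^-1)%:E by rewrite lee_fin invr_ge0 ltW.
have bound k' j' : heavy k' j' -> 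
    mu (dyadic_square3 k' j') <= (3 * K)%:E * ((eta^-1)%:E * U (dyadic_square k' j')) `^ e.
  move=> hv; apply: le_trans (mu_dyadic_square3 _ _) _.
  apply: lee_wpmul2l => //; apply: le_poweR => //.
    by apply: wmeas_ge0 => //; exact: polar_box_disc.
  by rewrite lee_pdivlMl// ltW.
elim: n k j => [|n IH] k j; rewrite ?stoppedS /=.
  case: ifPn => [|_]; first exact: bound.
  rewrite measure0 mule_ge0// poweR_ge0//.
case: ifPn => [|_]; first exact: bound.
apply: le_trans (measureU2 _ _ _) _; try exact: measurable_stopped.
apply: le_trans (leeD (IH _ _) (IH _ _)) _.
rewrite -ge0_muleDr ?poweR_ge0//; apply: lee_wpmul2l => //.
have Qd k' j' : dyadic_square k' j' `<=` (disc : set C) by exact: polar_box_disc.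
apply: le_trans (poweR_superadditive _ _ _ e1 _ _) _; rewrite ?mule_ge0 ?U_ge0//.
apply: le_poweR => //; first by rewrite adde_ge0 ?mule_ge0 ?U_ge0.
rewrite -ge0_muleDr ?U_ge0//; apply: lee_wpmul2l => //.
apply: integral_setU_origin; try exact: measurable_dyadic_square.
- by apply: measurable_u => //; exact: measurable_dyadic_square.
- by move=> z /Qd; exact: u0.
- exact: dyadic_child_l.
- exact: dyadic_child_r.
- exact: dyadic_children_disjoint.
Qed.

(** Two trees are searched, over [0, 2 pi) and [2 pi, 4 pi), because the second of
    two adjacent dyadic intervals may begin at 2 pi. *)
Definition heavy_region : set C :=
  \bigcup_n (stopped heavy n 0 0 `|` stopped heavy n 0 1).

Lemma measurable_heavy_region : measurable heavy_region.
Proof.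
by apply: bigcupT_measurable => n; apply: measurableU; exact: measurable_stopped.
Qed.

Lemma mu_heavy_region :
  mu heavy_region <= (6 * K)%:E * ((eta^-1)%:E * U disc) `^ e.
Proof.
have e0 : (0 <= e)%R by apply: le_trans e1.
have eta'0 : 0 <= (eta^-1)%:E by rewrite lee_fin invr_ge0 ltW.
pose F n : set C := stopped heavy n 0 0 `|` stopped heavy n 0 1.
have mF n : measurable (F n) by apply: measurableU; exact: measurable_stopped.
have cv : mu (F n) @[n --> \oo] --> mu heavy_region.
  apply: nondecreasing_cvg_mu => //; first exact: measurable_heavy_region.
  apply/nondecreasing_seqP => n; apply/subsetPset.
  by apply: setUSS; exact: stopped_mono.
rewrite -(cvg_lim _ cv)//; apply: lime_le; first by apply/cvg_ex; eexists; exact: cv.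
apply: nearW => n; apply: le_trans (measureU2 _ _ _) _; try exact: measurable_stopped.
have -> : ((6 * K)%:E = (3 * K)%:E + (3 * K)%:E).
  by rewrite -!EFinD; congr EFin; ring.
have H j : mu (stopped heavy n 0 j) <= (3 * K)%:E * ((eta^-1)%:E * U disc) `^ e.
  apply: le_trans (mu_stopped _ _ _) _.
  apply: lee_wpmul2l; first by rewrite lee_fin mulr_ge0.
  apply: le_poweR => //; first by rewrite mule_ge0// U_ge0//; exact: polar_box_disc.
  apply: lee_wpmul2l => //; apply: le_U => //.
  - exact: measurable_dyadic_square.
  - exact: measurable_disc.
  - exact: polar_box_disc.
by rewrite ge0_muleDl ?lee_fin ?mulr_ge0//; apply: leeD; exact: H.
Qed.

Variable D : R.
Hypothesis D0 : (0 < D)%R.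
Hypothesis wD : forall (I : interval R) (a L : R), is_arc I ->
  (arc_length I <= L <= 2 * arc_length I)%R ->
  wmeas w (half_open_square a L) <= D%:E * wmeas w (carleson_square I).

(** Two adjacent dyadic squares of the scale of I cover the square over I, and
    their weights are at most D times its weight. So if u has average more than
    2 D eta over it, then one of the two is heavy, and its enlargement contains the
    square over I. *)
Lemma heavy_region_cover (I : interval R) : is_arc I ->
  (2 * D * eta)%:E * wmeas w (carleson_square I) < U (carleson_square I) ->
  carleson_square I `<=` heavy_region.
Proof.
move=> aI big; have [k [j [jk lk sub]]] := arc_in_dyadic _ aI.
have mI := measurable_carleson_square _ aI.
have Qd k' j' : dyadic_square k' j' `<=` (disc : set C) by exact: polar_box_disc.
have L0 := dyadic_length_gt0 k (R := R); set L := dyadic_length k in lk sub L0.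
have subQ : carleson_square I `<=` dyadic_square k j `|` dyadic_square k j.+1.
  apply: subset_trans sub _; rewrite /dyadic_square /half_open_square -polar_boxU.
  apply: polar_boxS => // t; rewrite /= !in_itv/= -/L -natr1 !mulrDl mul1r => /andP[t1 t2].
  by have [h|h] := ltP t (j%:R * L + L)%R; [left|right]; lra.
have mQ k' j' := @measurable_dyadic_square R k' j'.
have [i ij hv] : exists2 i, (j <= i <= j.+1)%N & heavy k i.
  apply: contrapT => nh.
  have nh1 i : (j <= i <= j.+1)%N -> U (dyadic_square k i) <=
      (D * eta)%:E * wmeas w (carleson_square I).
    move=> ij; rewrite mulrC EFinM -muleA.
    apply: (@le_trans _ _ (eta%:E * wmeas w (dyadic_square k i))).
      by rewrite leNgt; apply/negP => hv; apply: nh; exists i.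
    apply: lee_wpmul2l; first by rewrite lee_fin ltW.
    exact: wD.
  move: big; apply/negP; rewrite -leNgt.
  have UQd : dyadic_square k j `|` dyadic_square k j.+1 `<=` (disc : set C).
    by rewrite subUset.
  apply: (@le_trans _ _ (U (dyadic_square k j `|` dyadic_square k j.+1))).
    by apply: le_U => //; exact: measurableU.
  apply: le_trans (le_integral_setU _ _ _ _ _ _ _) _ => //.
  - by apply: measurable_u => //; exact: measurableU.
  - by move=> z /UQd; exact: u0.
  rewrite -mulrA mulr_natl mulr2n EFinD ge0_muleDl ?lee_fin ?mulr_ge0 ?(ltW D0) ?(ltW eta0)//.
  by apply: leeD; apply: nh1; rewrite ?leqnn ?leqnSn ?andbT//=.
have subi : carleson_square I `<=` dyadic_square3 k i.
  apply: subset_trans sub _; apply: polar_boxS => // t.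
  rewrite /= !in_itv/= -/L => /andP[t1 t2].
  have i1 : (j%:R <= i%:R :> R)%R by rewrite ler_nat; case/andP: ij.
  have i2 : (i%:R <= j%:R + 1 :> R)%R by rewrite natr1 ler_nat; case/andP: ij.
  have h1 : ((i%:R - 1) * L <= j%:R * L)%R by apply: ler_wpM2r; [exact: ltW|lra].
  have h2 : ((j%:R + 2) * L <= (i%:R + 2) * L)%R by apply: ler_wpM2r; [exact: ltW|lra].
  by rewrite (le_trans h1)//= (lt_le_trans t2).
apply: subset_trans subi _ => z zi; exists k => //.
have [ik|ik] := ltnP i (2 ^ k).
  left; refine (stopped_cover heavy k k 0 0 i (leqnn k) _ hv z zi).
  by rewrite mul0n mul1n.
right; refine (stopped_cover heavy k k 0 1 i (leqnn k) _ hv z zi).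
rewrite mul1n ik/= mul2n -addnn; case/andP: ij => _ ij.
apply: leq_ltn_trans ij _; apply: leq_ltn_trans jk _.
by rewrite -[X in (X < _)%N]addn0 ltn_add2l expn_gt0.
Qed.

End weak_type.

(** * Lower integrals and dyadic levels *)
Section integral_monotone.
Local Open Scope ereal_scope.
Context d (T : measurableType d) (R : realType).
Variable mu : {measure set T -> \bar R}.

(** The integral of a nonnegative function is a supremum over the simple functions
    below it, which is monotone without measurability. The maximal function is
    integrated in this sense. *)
Lemma le_lower_integral (D : set T) (f g : T -> \bar R) :
  (forall x, D x -> 0 <= f x) -> (forall x, D x -> f x <= g x) ->
  \int[mu]_(x in D) f x <= \int[mu]_(x in D) g x.
Proof.
move=> f0 fg; have g0 x : D x -> 0 <= g x.
  by move=> Dx; apply: le_trans (f0 _ Dx) (fg _ Dx).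
rewrite !ge0_integralE//; apply: le_ereal_sup => _ [h hf <-]; exists h => // x.
apply: le_trans (hf x) _; rewrite !patchE; case: ifPn => //.
by rewrite inE; exact: fg.
Qed.

End integral_monotone.

Section real_estimates.
Context {R : realType}.

Lemma powR2_gt1 (b : R) : 0 < b -> 1 < 2 `^ b.
Proof.
move=> b0; have : 1 `^ b < 2 `^ b :> R by rewrite gt0_ltr_powR ?nnegrE// ltr1n.
by rewrite powR1.
Qed.

Lemma geometric_constant_ge0 (b : R) : 0 < b -> 0 <= (1 - (2 `^ b)^-1)^-1.
Proof.
move=> b0; rewrite invr_ge0 subr_ge0 invf_le1; first exact/ltW/powR2_gt1.
by rewrite powR_gt0.
Qed.

(** The terms Y i = (y 2 ^ i) ^ b satisfy (1 - 2 ^ - b) Y i = Y i - Y (i - 1), so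
    the sum of those below h ^ b telescopes. *)
Lemma level_sum_le (b h y : R) n : 0 < b -> 0 <= h -> 0 < y ->
  \sum_(i < n) (if y * 2 ^+ i < h then (y * 2 ^+ i) `^ b else 0) <=
  (1 - (2 `^ b)^-1)^-1 * h `^ b.
Proof.
move=> b0 h0 y0.
set th := 2 `^ b.
have th1 : 1 < th by exact: powR2_gt1.
have th0 : 0 < th by exact: lt_trans th1.
have d0 : 0 < 1 - th^-1 by rewrite subr_gt0 invf_lt1.
pose Y i := (y * 2 ^+ i) `^ b.
have Y0 i : 0 < Y i by rewrite powR_gt0// mulr_gt0// exprn_gt0.
have YS i : Y i.+1 = th * Y i.
  by rewrite /Y exprS mulrCA (powRM _ (ler0n _ 2))// mulr_ge0// ltW.
suff [H _] : (1 - th^-1) * (\sum_(i < n) (if y * 2 ^+ i < h then Y i else 0)) <= h `^ b /\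
    (1 - th^-1) * (\sum_(i < n) (if y * 2 ^+ i < h then Y i else 0)) <= Y n / th.
  by rewrite ler_pdivlMl.
elim: n => [|n [IH1 IH2]].
  by rewrite big_ord0 mulr0; split; rewrite ?powR_ge0// divr_ge0// ltW.
rewrite big_ord_recr/= mulrDr YS mulrAC divff ?gt_eqF// mul1r.
case: ifPn => hn.
  have E : (1 - th^-1) * \sum_(i < n) (if y * 2 ^+ i < h then Y i else 0) +
      (1 - th^-1) * Y n <= Y n.
    by rewrite (mulrBl _ 1) mul1r (mulrC th^-1); move: IH2; lra.
  split => //; apply: le_trans E _.
  by apply: ge0_ler_powR; rewrite ?nnegrE//; [exact: ltW|rewrite mulr_ge0// ltW|exact: ltW].
rewrite mulr0 addr0; split => //; apply: le_trans IH2 _.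
by rewrite ler_pdivrMr// ler_peMr// ltW.
Qed.

(** Homogeneity in eta: in x ^ e = x * x ^ (e - 1) with x = a / eta, the first
    factor is kept, to be summed over the levels, and Chebyshev's bound
    x <= eta ^ (- s) Phi is spent on the second. *)
Lemma level_term_le (s e c eta a Phi : R) : 1 <= e -> 0 < eta -> 0 < c ->
  0 <= a -> 0 <= Phi -> a <= eta `^ (1 - s) * Phi ->
  (c * eta) `^ (s * e) * (eta^-1 * a) `^ e <=
  c `^ (s * e) * Phi `^ (e - 1) * (eta `^ (s - 1) * a).
Proof.
move=> e1 eta0 c0 a0 P0 aP.
have eta'0 : 0 <= eta^-1 by rewrite invr_ge0 ltW.
have D (x y : R) : eta `^ (x + y) = eta `^ x * eta `^ y.
  by rewrite powRD//; apply/implyP => _; rewrite gt_eqF.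
have e0 : e != 0 by apply/eqP => E; move: e1; rewrite E; lra.
have x0 : 0 <= eta^-1 * a by rewrite mulr_ge0.
have H : (eta^-1 * a) `^ e = (eta^-1 * a) * (eta^-1 * a) `^ (e - 1).
  rewrite -{2}(powRr1 x0) -powRD ?subrKC//.
  by apply/implyP; rewrite (negbTE e0).
have xP : eta^-1 * a <= eta `^ (- s) * Phi.
  apply: le_trans (ler_wpM2l eta'0 aP) _.
  rewrite mulrA -(powR_inv1 (ltW eta0)) -D.
  by rewrite (_ : -1 + (1 - s) = - s)//; ring.
have : (eta^-1 * a) `^ (e - 1) <= eta `^ (- s * (e - 1)) * Phi `^ (e - 1).
  rewrite powRrM -powRM ?powR_ge0//.
  by apply: ge0_ler_powR; rewrite ?nnegrE ?subr_ge0 ?mulr_ge0 ?powR_ge0.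
move=> /(ler_wpM2l x0); rewrite -H => H2.
rewrite (powRM _ (ltW c0) (ltW eta0)).
apply: le_trans (ler_wpM2l _ H2) _; first by rewrite mulr_ge0 ?powR_ge0.
rewrite -(powR_inv1 (ltW eta0)).
have -> : s - 1 = s * e + (-1) + (- s * (e - 1)) by ring.
by rewrite !D le_eqVlt; apply/orP; left; apply/eqP; ring.
Qed.

Lemma level_exists (x l : R) : 0 < l -> l < x ->
  exists i, l * 2 ^+ i < x <= 2 * (l * 2 ^+ i).
Proof.
move=> l0 lx.
have ex : exists i, x <= l * 2 ^+ i.+1.
  exists (Num.truncn (x / l)); rewrite mulrC -ler_pdivrMr//.
  have lt2 n : n%:R <= 2 ^+ n :> R by rewrite -natrX ler_nat ltnW// ltn_expl.
  by apply: le_trans (lt2 _); apply: ltW; exact: truncnS_gt.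
have [i Pi mini] := find_ex_minn ex.
exists i; apply/andP; split; last by rewrite mulrCA -exprS.
case: i {Pi} mini => [|i] mini; first by rewrite expr0 mulr1.
by rewrite ltNge; apply/negP => /mini; rewrite ltnn.
Qed.

End real_estimates.

(** * The strong-type estimate *)
Section strong_type.
Context {R : realType}.
Local Notation C := (cplane R).
Local Open Scope ereal_scope.
Variable w : C -> R.
Hypothesis ww : weight w.
Hypothesis rw : radial w.
Variable D : R.
Hypothesis D0 : (0 < D)%R.
Hypothesis wD : forall (I : interval R) (a L : R), is_arc I ->
  (arc_length I <= L <= 2 * arc_length I)%R ->
  wmeas w (half_open_square a L) <= D%:E * wmeas w (carleson_square I).
Variable mu : {measure set C -> \bar R}.
Variables (e K : R).
Hypothesis e1 : (1 <= e)%R.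
Hypothesis K0 : (0 <= K)%R.
Hypothesis muK : forall I, is_arc I ->
  mu (carleson_square I) <= K%:E * (wmeas w (carleson_square I)) `^ e.

Lemma cmod_RtoC_ge0 (x : R) : (0 <= x)%R -> cmod (RtoC x : C) = x.
Proof. by move=> x0; rewrite cmod_RtoC ger0_norm. Qed.

Variable h : C -> R.
Hypothesis h0 : forall z, (0 <= h z)%R.
Hypothesis mh : measurable_fun disc (h : C -> measurableTypeR R).
Variable s : R.
Hypothesis s1 : (1 < s)%R.
Hypothesis hfin : \int[areaA]_(z in disc) ((h z) `^ s * w z)%:E < +oo.

Let Phi : R := fine (\int[areaA]_(z in disc) ((h z) `^ s * w z)%:E).

Lemma w_ge0 z : disc z -> (0 <= w z)%R.
Proof. by move=> zd; rewrite -lee_fin; exact: weight_ge0. Qed.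

Lemma hs_ge0 z : disc z -> 0 <= ((h z) `^ s * w z)%:E.
Proof. by move=> zd; rewrite lee_fin mulr_ge0 ?powR_ge0 ?w_ge0. Qed.

Lemma PhiE : \int[areaA]_(z in disc) ((h z) `^ s * w z)%:E = Phi%:E.
Proof.
rewrite fineK// ge0_fin_numE//; apply: integral_ge0 => z; exact: hs_ge0.
Qed.

Lemma Phi_ge0 : (0 <= Phi)%R.
Proof. by apply: fine_ge0; apply: integral_ge0 => z; exact: hs_ge0. Qed.

Lemma measurable_w_disc : measurable_fun disc (w : C -> measurableTypeR R).
Proof. by apply/measurable_EFinP; exact: weight_measurable. Qed.

Lemma measurable_hs : measurable_fun disc (fun z => ((h z) `^ s * w z)%:E).
Proof.
apply/measurable_EFinP; apply: measurable_funM; last exact: measurable_w_disc.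
by apply: (measurableT_comp (measurable_powR _)).
Qed.

Definition upper (eta : R) (z : C) : \bar R :=
  ((if (eta < h z)%R then h z else 0%R) * w z)%:E.

Lemma upper_ge0 eta z : disc z -> 0 <= upper eta z.
Proof.
by move=> zd; rewrite lee_fin mulr_ge0 ?w_ge0//; case: ifP.
Qed.

Lemma measurable_upper eta : measurable_fun disc (upper eta).
Proof.
apply/measurable_EFinP; apply: measurable_funM; last exact: measurable_w_disc.
apply: measurable_fun_if => //; first exact: measurable_disc.
  exact: measurable_fun_ltr.
by apply: measurable_funS mh; [exact: measurable_disc|exact: subIsetl].
Qed.

Definition level_mass (eta : R) : \bar R := \int[areaA]_(z in disc) upper eta z.

(** Chebyshev: h <= eta ^ (1 - s) h ^ s where h > eta. *)
Lemma level_mass_le eta : (0 < eta)%R ->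
  level_mass eta <= (eta `^ (1 - s) * Phi)%:E.
Proof.
move=> eta0; rewrite EFinM -PhiE -ge0_integralZl//; last 4 first.
- exact: measurable_disc.
- exact: measurable_hs.
- by move=> z; exact: hs_ge0.
- by rewrite lee_fin powR_ge0.
apply: ge0_le_integral => //.
- exact: measurable_disc.
- by move=> z; exact: upper_ge0.
- exact: measurable_upper.
- by apply: emeasurable_funM => //; exact: measurable_hs.
move=> z zd; rewrite -EFinM lee_fin mulrA; apply: ler_wpM2r; first exact: w_ge0.
case: ifPn => hz; last by rewrite mulr_ge0 ?powR_ge0.
have hp : (0 < h z)%R by exact: lt_trans hz.
rewrite (_ : h z `^ s = h z `^ (s - 1) * h z)%R; last first.
  rewrite -{3}(powRr1 (h0 z)) -powRD ?subrK//.
  by apply/implyP => _; rewrite gt_eqF.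
rewrite mulrA ler_peMl//.
rewrite (_ : 1 - s = - (s - 1))%R; last by ring.
rewrite powRN mulrC ler_pdivlMr ?powR_gt0// mul1r.
by apply: ge0_ler_powR; rewrite ?nnegrE ?subr_ge0 ?h0// ltW.
Qed.

Lemma level_mass_ge0 eta : 0 <= level_mass eta.
Proof. by apply: integral_ge0 => z; exact: upper_ge0. Qed.

Lemma level_mass_fin eta : (0 < eta)%R -> level_mass eta \is a fin_num.
Proof.
move=> eta0; rewrite ge0_fin_numE ?level_mass_ge0//.
by apply: le_lt_trans (level_mass_le _ eta0) _; rewrite ltry.
Qed.

Let c : R := (2 * D + 1)%R.
Let c0 : (0 < c)%R. Proof. by rewrite /c; move: D0; lra. Qed.

Local Notation Mh := (maximal w (fun z => RtoC (h z))).
Local Notation region eta := (heavy_region w (upper eta) eta).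

(** The part of h below eta = lam / (2 D + 1) contributes at most eta to an average,
    so an average of h above lam leaves more than lam - eta = 2 D eta for the part
    above eta, and [heavy_region_cover] applies to the latter. *)
Lemma maximal_level (lam : R) z : (0 < lam)%R -> lam%:E < Mh z ->
  region (lam / c) z.
Proof.
move=> lam0 /ereal_sup_gt[_ [I [aI zI] <-]].
set eta := (lam / c)%R; have eta0 : (0 < eta)%R by rewrite divr_gt0.
have mI := measurable_carleson_square _ aI; have Id := @carleson_square_disc _ I.
have wI := wmeas_carleson_gt0 _ ww rw _ aI.
have fI := wmeas_fin _ ww _ mI Id.
under eq_integral do rewrite cmod_RtoC_ge0//.
rewrite -(fineK fI); set W := fine _; have W0 : (0 < W)%R by rewrite fine_gt0// wI ltey_eq fI.
rewrite inver (gt_eqF W0) lte_pdivlMr// => big.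
apply: (heavy_region_cover _ _ _ _ _ eta0 D D0 wD I aI) zI => //.
- by move=> y; exact: upper_ge0.
- exact: measurable_upper.
have mu' : measurable_fun (carleson_square I) (upper eta).
  exact: measurable_funS measurable_disc Id (measurable_upper _).
have mwI : measurable_fun (carleson_square I) (fun z => (w z)%:E).
  exact: measurable_weight.
have cut : \int[areaA]_(xi in carleson_square I) (h xi * w xi)%:E <=
    \int[areaA]_(xi in carleson_square I) upper eta xi + (eta * W)%:E.
  rewrite EFinM fineK// /wmeas -ge0_integralZl//; last 2 first.
  - by move=> y /Id; exact: weight_ge0.
  - by rewrite lee_fin ltW.
  rewrite -ge0_integralD//; last 3 first.
  - by move=> y /Id; exact: upper_ge0.
  - by move=> y /Id yd; rewrite mule_ge0// ?lee_fin ?(ltW eta0)// w_ge0.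
  - by apply: emeasurable_funM.
  apply: ge0_le_integral => //.
  - by move=> y /Id yd; rewrite lee_fin mulr_ge0 ?w_ge0.
  - apply/measurable_EFinP; apply: measurable_funM.
      exact: measurable_funS measurable_disc Id mh.
    exact: measurable_funS measurable_disc Id measurable_w_disc.
  - by apply: emeasurable_funD => //; exact: emeasurable_funM.
  - move=> y /Id yd; rewrite -EFinM -EFinD lee_fin -mulrDl.
    apply: ler_wpM2r; first exact: w_ge0.
    by case: ifPn => [_|]; [rewrite lerDl ltW|rewrite -leNgt add0r].
have := lt_le_trans big cut.
rewrite -lteBlDr// => /(le_lt_trans _); apply.
rewrite -(fineK fI) -/W -!EFinM -EFinB lee_fin -mulrBl; apply: ler_wpM2r; first exact: ltW.
(* lam - eta = 2 D eta, by the choice of c *)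
have -> : lam = (c * eta)%R by rewrite /eta mulrC divfK// gt_eqF.
by rewrite /c; lra.
Qed.

Lemma is_arc_circle : is_arc (`[- pi, pi]%R : interval R).
Proof.
rewrite /is_arc lebesgue_measure_itv/= lte_fin gtrN ?pi_gt0// -EFinD opprK lte_fin lee_fin.
by have := @pi_gt0 R; lra.
Qed.

Lemma disc_sub_carleson : disc `<=` carleson_square (`[- pi, pi]%R : interval R).
Proof.
move=> z zd; rewrite carleson_squareE.
have rho0 : (1 - arc_length `[- pi, pi]%R <= 0 :> R)%R.
  rewrite /arc_length lebesgue_measure_itv/= lte_fin gtrN ?pi_gt0//= opprK.
  by have := @pihalf_ge1 R; lra.
have [zp|zn] := ltP 0%R (cmod z); last first.
  exists 0%R, 0%R; split => //.
  - by rewrite (cmod_eq0 _ zn) /cpolar !mul0r.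
  - by rewrite /= in_itv/= oppr_le0 pi_ge0.
  - by rewrite rho0 ltr01.
have E : ((z.1 / cmod z) ^+ 2 + (z.2 / cmod z) ^+ 2 = 1 :> R)%R.
  rewrite !expr_div_n -mulrDl sqr_sqrtr ?addr_ge0 ?sqr_ge0// divff//.
  by move: zp; rewrite /cmod sqrtr_gt0 => /lt0r_neq0.
set x := (z.1 / cmod z)%R in E; set y := (z.2 / cmod z)%R in E.
have x1 : (-1 <= x <= 1)%R.
  rewrite -ler_norml -(ler_sqr (normr_ge0 _)) ?nnegrE// real_normK ?num_real//.
  by rewrite expr1n -E lerDl sqr_ge0.
have zx : (cmod z * x = z.1 :> R)%R by rewrite /x mulrC divfK// gt_eqF.
have zy : (cmod z * y = z.2 :> R)%R by rewrite /y mulrC divfK// gt_eqF.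
have sy : sin (acos x) = `|y|%R.
  by rewrite sin_acos// -sqrtr_sqr -E; congr Num.sqrt; ring.
exists (cmod z), (if (0 <= y)%R then acos x else - acos x)%R; split.
- rewrite /cpolar; case: ifPn => y0.
    rewrite acosK ?in_itv// sy ger0_norm// zx zy.
    by case: z {zd zp E x x1 y zx zy sy y0}.
  rewrite cosN sinN acosK ?in_itv// sy ltr0_norm ?ltNge// opprK zx zy.
  by case: z {zd zp E x x1 y zx zy sy y0}.
- have a0 := acos_ge0 x1; have api := acos_lepi x1.
  by rewrite /= in_itv/=; case: ifP => _; lra.
- exact: cmod_ge0.
- by rewrite (le_trans rho0) ?cmod_ge0.
Qed.

Lemma mu_disc_fin : mu disc < +oo.
Proof.
have aI := is_arc_circle.
have mI := measurable_carleson_square _ aI.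
have Id := @carleson_square_disc R `[- pi, pi]%R.
apply: (@le_lt_trans _ _ (mu (carleson_square `[- pi, pi]%R))).
  apply: le_measure; rewrite ?inE//; first exact: measurable_disc.
  exact: disc_sub_carleson.
apply: le_lt_trans (muK _ aI) _.
rewrite -(fineK (wmeas_fin _ ww _ mI Id)) poweR_EFin -EFinM ltry//.
Qed.

Let t : R := (s * e)%R.
Let t0 : (0 < t)%R. Proof. by rewrite mulr_gt0//; move: s1 e1; lra. Qed.

(** 6 is the constant of [mu_heavy_region], 2 c the quotient of 2 lam by the level
    eta = lam / c, and the last factor the sum of the geometric series of
    [level_sum_le]. *)
Definition strong_constant : R :=
  (6 * (2 * c) `^ t * (1 - (2 `^ (s - 1))^-1)^-1)%R.

(** A discrete layer-cake formula: a number above lam lies between some lam 2 ^ i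
    and its double, so a single term of the series dominates; an infinite value
    exceeds all levels. The levels at most lam are summed up in the first term. *)
Lemma maximal_pointwise (lam : R) z : (0 < lam)%R -> 0 <= Mh z ->
  (Mh z) `^ t <= (lam `^ t)%:E +
    \sum_(i <oo) ((2 * (lam * 2 ^+ i)) `^ t *
      \1_(region (lam * 2 ^+ i / c)) z)%:E.
Proof.
move=> lam0 M0.
have term0 i : 0 <= ((2 * (lam * 2 ^+ i)) `^ t * \1_(region (lam * 2 ^+ i / c)) z)%:E.
  by rewrite lee_fin mulr_ge0 ?powR_ge0.
have lami i : (0 < lam * 2 ^+ i)%R by rewrite mulr_gt0// exprn_gt0.
have sum0 : 0 <= \sum_(i <oo) ((2 * (lam * 2 ^+ i)) `^ t *
      \1_(region (lam * 2 ^+ i / c)) z)%:E by exact: nneseries_ge0.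
have one i : (lam * 2 ^+ i)%:E < Mh z ->
    ((2 * (lam * 2 ^+ i)) `^ t)%:E <= \sum_(i <oo) ((2 * (lam * 2 ^+ i)) `^ t *
      \1_(region (lam * 2 ^+ i / c)) z)%:E.
  move=> iM; have zi := maximal_level _ _ (lami i) iM.
  apply: le_trans (nneseries_lim_ge i.+1 _); last by move=> *; exact: term0.
  rewrite big_nat_recr//=.
  rewrite [X in _ <= _ + X](_ : _ = ((2 * (lam * 2 ^+ i)) `^ t)%:E); last first.
    by rewrite indicE mem_set// mulr1.
  by apply: leeDr; apply: sume_ge0 => *; exact: term0.
case E : (Mh z) M0 => [x| |]// M0; last first.
  rewrite (_ : \sum_(i <oo) _ = +oo) ?addey ?leey//.
  apply/eqyP => A A0.
  (* a number above lam whose t-th power is at least A *)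
  have [i /andP[_ iA]] : exists i,
      (lam * 2 ^+ i < A `^ t^-1 + 2 * lam <= 2 * (lam * 2 ^+ i))%R.
    by apply: level_exists => //; have := powR_ge0 A t^-1; lra.
  apply: le_trans (one i _); last by rewrite E ltry.
  have -> : A = ((A `^ t^-1) `^ t)%R.
    by rewrite -powRrM mulVf ?gt_eqF// powRr1// ltW.
  rewrite lee_fin; apply: ge0_ler_powR; rewrite ?nnegrE ?powR_ge0//; first exact: ltW.
    by rewrite mulr_ge0// ltW// lami.
  by apply: le_trans iA; rewrite lerDl mulr_ge0// ltW.
have [xl|lx] := leP x lam.
  apply: (@le_trans _ _ (lam `^ t)%:E); last by rewrite leeDl.
  rewrite poweR_EFin lee_fin; apply: ge0_ler_powR; rewrite ?nnegrE -?lee_fin//; exact: ltW.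
have [i /andP[i1 i2]] := level_exists _ _ lam0 lx.
apply: le_trans (_ : ((2 * (lam * 2 ^+ i)) `^ t)%:E <= _).
  rewrite poweR_EFin lee_fin; apply: ge0_ler_powR; rewrite ?nnegrE -?lee_fin//.
    exact: ltW.
  by rewrite lee_fin mulr_ge0// ltW// lami.
apply: le_trans (one i _) _; first by rewrite E lte_fin.
by rewrite leeDr// lee_fin powR_ge0.
Qed.

(** The series is moved under the integral sign, where it is the geometric sum of
    the levels below h(z). *)
Lemma sum_levels (y : R) : (0 < y)%R ->
  \sum_(i <oo) ((y * 2 ^+ i) `^ (s - 1))%:E * level_mass (y * 2 ^+ i) <=
  ((1 - (2 `^ (s - 1))^-1)^-1 * Phi)%:E.
Proof.
move=> y0.
have s0 : (0 < s - 1)%R by rewrite subr_gt0.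
have mterm i : measurable_fun disc
    (fun z => ((y * 2 ^+ i) `^ (s - 1))%:E * upper (y * 2 ^+ i) z).
  by apply: emeasurable_funM => //; exact: measurable_upper.
have term0 i z : disc z ->
    0 <= ((y * 2 ^+ i) `^ (s - 1))%:E * upper (y * 2 ^+ i) z.
  by move=> zd; rewrite mule_ge0 ?upper_ge0// lee_fin powR_ge0.
rewrite (eq_eseriesr (g := fun i => \int[areaA]_(z in disc)
    (((y * 2 ^+ i) `^ (s - 1))%:E * upper (y * 2 ^+ i) z))); last first.
  move=> i _; rewrite ge0_integralZl//.
  - exact: measurable_disc.
  - exact: measurable_upper.
  - by move=> z; exact: upper_ge0.
  - by rewrite lee_fin powR_ge0.
rewrite -integral_nneseries//; last exact: measurable_disc.
rewrite EFinM -PhiE -ge0_integralZl//; last 4 first.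
- exact: measurable_disc.
- exact: measurable_hs.
- by move=> z; exact: hs_ge0.
- by rewrite lee_fin geometric_constant_ge0.
apply: le_lower_integral => z zd; first by apply: nneseries_ge0 => i _ _; exact: term0.
apply: lime_le; first by apply: is_cvg_nneseries => i _ _; exact: term0.
apply: nearW => n; rewrite big_mkord.
have -> : \sum_(i < n) ((y * 2 ^+ i) `^ (s - 1))%:E * upper (y * 2 ^+ i) z =
   ((\sum_(i < n) (if (y * 2 ^+ i < h z)%R then (y * 2 ^+ i) `^ (s - 1) else 0)) *
    (h z * w z))%:E.
  rewrite mulr_suml -sumEFin; apply: eq_bigr => i _; rewrite /upper -EFinM; congr EFin.
  by case: ifPn => _; rewrite ?mul0r ?mulr0.
rewrite -EFinM lee_fin.
have H := level_sum_le (s - 1) (h z) y n s0 (h0 z) y0.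
have hw : (0 <= h z * w z)%R by rewrite mulr_ge0// w_ge0.
apply: le_trans (ler_wpM2r hw H) _.
rewrite -[leLHS]mulrA; apply: ler_wpM2l.
  exact: geometric_constant_ge0.
rewrite mulrA; apply: ler_wpM2r; first exact: w_ge0.
by rewrite -{2}(powRr1 (h0 z)) -powRD ?subrK//; apply/implyP; rewrite gt_eqF//; lra.
Qed.

Lemma maximal_ge0 z : disc z -> 0 <= Mh z.
Proof.
move=> zd; pose I : interval R := `[- pi, pi]%R.
apply: (@le_trans _ _ ((\int[areaA]_(xi in carleson_square I) (cmod (RtoC (h xi)) * w xi)%:E)
  / wmeas w (carleson_square I))).
  apply: mule_ge0; last by rewrite inve_ge0 wmeas_ge0//; exact: carleson_square_disc.
  apply: integral_ge0 => y /carleson_square_disc yd.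
  by rewrite lee_fin mulr_ge0 ?cmod_ge0// w_ge0.
apply: ereal_sup_ubound; exists I => //; split; first exact: is_arc_circle.
exact: disc_sub_carleson.
Qed.

Lemma level_bound (eta : R) : (0 < eta)%R ->
  ((2 * c * eta) `^ t)%:E * mu (region eta) <=
  (6 * K * ((2 * c) `^ t * Phi `^ (e - 1)))%:E *
  ((eta `^ (s - 1))%:E * level_mass eta).
Proof.
move=> eta0.
have mr : mu (region eta) <= (6 * K)%:E * ((eta^-1)%:E * level_mass eta) `^ e.
  apply: (mu_heavy_region _ ww rw mu e K e1 K0 muK _ _ _ _ eta0).
  - by move=> z; exact: upper_ge0.
  - exact: measurable_upper.
apply: le_trans (lee_wpmul2l _ mr) _; first by rewrite lee_fin powR_ge0.
have fA := level_mass_fin _ eta0.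
have := level_mass_le _ eta0; rewrite -(fineK fA); set a := fine _ => aP.
have a0 : (0 <= a)%R by rewrite fine_ge0// level_mass_ge0.
rewrite -!EFinM lee_fin.
rewrite lee_fin in aP.
have c20 : (0 < 2 * c)%R by rewrite mulr_gt0.
have := level_term_le s e (2 * c)%R eta a Phi e1 eta0 c20 a0 Phi_ge0 aP.
rewrite -/t => H.
have K6 : (0 <= 6 * K)%R by rewrite mulr_ge0.
by have := ler_wpM2l K6 H; rewrite mulrCA !mulrA.
Qed.

(** Marcinkiewicz interpolation of the weak-type estimate: integrate the layer-cake
    bound and sum the levels. The contribution lam ^ t mu(disc) of the small values
    is made less than any eps by the choice of lam, since mu(disc) is finite by the
    Carleson condition on the whole circle. *)
Lemma maximal_strong_type :
  \int[mu]_(z in disc) ((Mh z) `^ t) <= (strong_constant * K * Phi `^ e)%:E.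
Proof.
have md := @measurable_disc R.
have PE : (Phi `^ (e - 1) * Phi = Phi `^ e)%R.
  have := Phi_ge0; rewrite le_eqVlt => /orP[/eqP <-|P0].
    by rewrite mulr0 powR0//; apply/eqP => E; move: e1; rewrite E; lra.
  rewrite -{2}(powRr1 (ltW P0)) -powRD ?subrK//.
  by apply/implyP => _; rewrite gt_eqF.
have fm : mu disc \is a fin_num by rewrite ge0_fin_numE// mu_disc_fin.
set m := fine (mu disc); have m0 : (0 <= m)%R by rewrite fine_ge0.
apply/lee_addgt0Pr => eps eps0.
pose lam := ((eps / (m + 1)) `^ t^-1)%R.
have m1 : (0 < m + 1)%R by rewrite ltr_wpDl.
have lam0 : (0 < lam)%R by rewrite powR_gt0// divr_gt0.
have lamt : (lam `^ t * m <= eps)%R.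
  rewrite /lam -powRrM mulVf ?gt_eqF// powRr1; last by apply: divr_ge0; exact: ltW.
  by rewrite mulrAC ler_pdivrMr//; apply: ler_wpM2l; [exact: ltW|rewrite lerDl].
pose y := (lam / c)%R; have y0 : (0 < y)%R by rewrite divr_gt0.
have lamy i : (lam * 2 ^+ i / c = y * 2 ^+ i)%R by rewrite /y mulrAC.
have lamy2 i : (2 * (lam * 2 ^+ i) = 2 * c * (y * 2 ^+ i))%R.
  by rewrite -lamy; field; rewrite gt_eqF.
have yi i : (0 < y * 2 ^+ i)%R by rewrite mulr_gt0// exprn_gt0.
have mreg i : measurable (region (lam * 2 ^+ i / c)) by exact: measurable_heavy_region.
pose f i (z : C) := ((2 * (lam * 2 ^+ i)) `^ t * \1_(region (lam * 2 ^+ i / c)) z)%:E.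
have f0 i z : 0 <= f i z by rewrite lee_fin mulr_ge0 ?powR_ge0.
have mf i : measurable_fun disc (f i).
  by apply/measurable_EFinP; apply: measurable_funM => //; exact: measurable_indic.
apply: (@le_trans _ _ (\int[mu]_(z in disc) ((lam `^ t)%:E + \sum_(i <oo) f i z))).
  apply: le_lower_integral => z zd; first exact: poweR_ge0.
  by apply: maximal_pointwise => //; exact: maximal_ge0.
rewrite ge0_integralD//; last 3 first.
- by move=> z _; rewrite lee_fin powR_ge0.
- by move=> z _; exact: nneseries_ge0.
- exact: ge0_emeasurable_sum.
rewrite integral_cst// addeC integral_nneseries//.
apply: leeD; last by rewrite -(fineK fm) -EFinM lee_fin.
have term i : \int[mu]_(z in disc) f i z <=
   (6 * K * ((2 * c) `^ t * Phi `^ (e - 1)))%:E *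
   (((y * 2 ^+ i) `^ (s - 1))%:E * level_mass (y * 2 ^+ i)).
  apply: le_trans (level_bound _ (yi i)).
  rewrite /f; under eq_integral do rewrite EFinM.
  rewrite ge0_integralZl//; last 2 first.
  - by apply/measurable_EFinP; exact: measurable_indic.
  - by rewrite lee_fin powR_ge0.
  rewrite integral_indic// lamy2 -lamy; apply: lee_wpmul2l; first by rewrite lee_fin powR_ge0.
  by apply: le_measure; rewrite ?inE//; exact: measurableI.
have lev0 i : 0 <= ((y * 2 ^+ i) `^ (s - 1))%:E * level_mass (y * 2 ^+ i).
  by rewrite mule_ge0 ?level_mass_ge0// lee_fin powR_ge0.
apply: le_trans (lee_nneseries _ (fun i _ => term i)) _.
  by move=> i _ _; exact: integral_ge0.
rewrite nneseriesZl; last by move=> i _; exact: lev0.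
apply: le_trans (lee_wpmul2l _ (sum_levels _ y0)) _.
  by rewrite lee_fin !mulr_ge0 ?powR_ge0.
rewrite -EFinM lee_fin -PE /strong_constant le_eqVlt; apply/orP; left; apply/eqP.
by ring.
Qed.

End strong_type.

(** * The norm of the maximal operator *)
Section operator_bounds.
Context {R : realType}.
Local Notation C := (cplane R).
Local Open Scope ereal_scope.
Variable w : C -> R.
Hypothesis ww : weight w.
Hypothesis rw : radial w.
Variables (p q alpha : R).
Hypothesis p0 : (0 < p)%R.
Hypothesis pq : (p <= q)%R.
Hypothesis alpha0 : (0 < alpha)%R.
Variable mu : {measure set C -> \bar R}.

Let q0 : (0 < q)%R. Proof. exact: lt_le_trans pq. Qed.
Let e1 : (1 <= q / p)%R. Proof. by rewrite ler_pdivlMr// mul1r. Qed.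

Lemma carleson_ratio (I : interval R) (K : \bar R) : is_arc I ->
  (mu (carleson_square I) / (wmeas w (carleson_square I)) `^ (q / p) <= K) =
  (mu (carleson_square I) <= K * (wmeas w (carleson_square I)) `^ (q / p)).
Proof.
move=> aI; have mI := measurable_carleson_square _ aI.
have wI := wmeas_carleson_gt0 _ ww rw _ aI.
have fI := wmeas_fin _ ww _ mI (@carleson_square_disc _ I).
rewrite -(fineK fI) in wI *; set W := fine _ in wI *.
have W0 : (0 < W `^ (q / p))%R by rewrite powR_gt0.
by rewrite poweR_EFin inver gt_eqF// lee_pdivrMr.
Qed.

Lemma carleson_sup_ge0 : 0 <= carleson_sup w p q mu.
Proof.
apply: (@le_trans _ _ (mu (carleson_square `[- pi, pi]%R)
   / (wmeas w (carleson_square `[- pi, pi]%R)) `^ (q / p))).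
  by rewrite mule_ge0// inve_ge0 poweR_ge0.
by apply: ereal_sup_ubound; exists `[- pi, pi]%R => //; exact: is_arc_circle.
Qed.

Definition indicator_fun (A : set C) (z : C) : C := RtoC (\1_A z).

Lemma cmod_indicator (A : set C) z : cmod (indicator_fun A z) = \1_A z.
Proof. by rewrite cmod_RtoC_ge0. Qed.

Lemma indic_powR (A : set C) z (r : R) : (r != 0)%R -> ((\1_A z : R) `^ r = \1_A z)%R.
Proof.
by move=> r0; rewrite indicE; case: (z \in A); rewrite /= ?powR1// powR0.
Qed.

Lemma integral_indicator (A E : set C) : A `<=` E ->
  \int[areaA]_(z in E) (\1_A z * w z)%:E = wmeas w A.
Proof.
move=> AE; rewrite /wmeas -{2}(setIidr AE) integral_mkcondr.
apply: eq_integral => z _; rewrite patchE indicE.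
by case: (z \in A); rewrite ?mul1r ?mul0r.
Qed.

Lemma Lpw_norm_indicator (A : set C) : A `<=` disc ->
  Lpw_norm w p (indicator_fun A) = (wmeas w A) `^ p^-1.
Proof.
move=> Ad; rewrite /Lpw_norm -(integral_indicator _ _ Ad); congr (_ `^ _).
by apply: eq_integral => z _; rewrite cmod_indicator indic_powR ?gt_eqF.
Qed.

Lemma maximal_indicator (I : interval R) z : is_arc I -> carleson_square I z ->
  1 <= maximal_power w alpha (indicator_fun (carleson_square I)) z.
Proof.
move=> aI zI; have mI := measurable_carleson_square _ aI.
have wI := wmeas_carleson_gt0 _ ww rw _ aI.
have fI := wmeas_fin _ ww _ mI (@carleson_square_disc _ I).
rewrite /maximal_power -(poweR1r alpha); apply: le_poweR; [exact: ltW|by []|].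
apply: le_trans (_ : (\int[areaA]_(xi in carleson_square I)
  (cmod (RtoC (cmod (indicator_fun (carleson_square I) xi) `^ alpha^-1)) * w xi)%:E)
    / wmeas w (carleson_square I) <= _); last first.
  by apply: ereal_sup_ubound; exists I.
under eq_integral do
  rewrite cmod_RtoC_ge0 ?powR_ge0// cmod_indicator indic_powR ?invr_eq0 ?gt_eqF//.
rewrite integral_indicator//.
rewrite -(fineK fI) inver gt_eqF ?fine_gt0 ?wI ?ltey_eq ?fI// -EFinM divff// gt_eqF//.
by rewrite fine_gt0// wI ltey_eq fI.
Qed.

(** Tested on the indicator of S(I), whose maximal function is at least 1 on S(I),
    boundedness reads mu(S(I)) ^ (1/q) <= c w(S(I)) ^ (1/p). *)
Lemma carleson_necessary (c : R) :
  op_bound w p mu q (maximal_power w alpha) c ->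
  carleson_sup w p q mu <= (c `^ q)%:E.
Proof.
move=> [c0 bnd]; apply: ge_ereal_sup => _ [I aI <-].
rewrite carleson_ratio//.
have mI := measurable_carleson_square _ aI; have Id := @carleson_square_disc _ I.
have fI := wmeas_fin _ ww _ mI Id.
set A := carleson_square I in mI Id fI *.
have := bnd (indicator_fun A); rewrite Lpw_norm_indicator// => /(_ _) H.
have {}H : Lq_norm mu q (maximal_power w alpha (indicator_fun A)) <=
    c%:E * wmeas w A `^ p^-1.
  apply: H; split; last by rewrite Lpw_norm_indicator// poweR_lty// ltey_eq fI.
  apply: measurable_funTS; apply: (measurableT_comp measurable_RtoC).
  exact: measurable_indic.
have mu_le : (mu A) `^ q^-1 <= c%:E * wmeas w A `^ p^-1.
  apply: le_trans H; apply: le_poweR; rewrite ?invr_ge0 ?(ltW q0)//.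
  rewrite -[leLHS](_ : \int[mu]_(z in disc) (\1_A z)%:E = _); last first.
    rewrite integral_indic//; last exact: measurable_disc.
    by rewrite setIidl.
  apply: le_lower_integral => z zd; first by rewrite lee_fin.
  rewrite indicE; have [zA|zA] := boolP (z \in A); last exact: poweR_ge0.
  rewrite /= -(poweR1r q); apply: le_poweR; [exact: ltW|by []|].
  rewrite inE in zA; apply: le_trans (lee_abs _).
  exact: maximal_indicator.
have w0 : 0 <= wmeas w A by exact: wmeas_ge0.
have : ((mu A) `^ q^-1) `^ q <= (c%:E * wmeas w A `^ p^-1) `^ q.
  by apply: le_poweR => //; [exact: ltW|exact: poweR_ge0].
rewrite -poweRrM mulVf ?gt_eqF// poweRe1//.
by rewrite poweRM ?poweR_ge0// -poweRrM poweR_EFin (mulrC (p^-1)%R).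
Qed.

Variables (D K : R).
Hypothesis pa : (1 < p * alpha)%R.
Hypothesis D0 : (0 < D)%R.
Hypothesis wD : forall (I : interval R) (a L : R), is_arc I ->
  (arc_length I <= L <= 2 * arc_length I)%R ->
  wmeas w (half_open_square a L) <= D%:E * wmeas w (carleson_square I).
Hypothesis K0 : (0 <= K)%R.
Hypothesis muK : carleson_sup w p q mu <= K%:E.

Local Notation SC := (strong_constant D (q / p) (p * alpha)).

(** With h = |phi| ^ (1 / alpha), the maximal function of h has to be raised to the
    power alpha q = (p alpha) (q / p), and h ^ (p alpha) = |phi| ^ p: this is
    [maximal_strong_type], where the hypothesis p alpha > 1 makes the exponent of
    the source space larger than 1. *)
Lemma carleson_sufficient :
  op_bound w p mu q (maximal_power w alpha) ((SC * K) `^ q^-1).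
Proof.
split; first exact: powR_ge0.
move=> phi [mphi Lphi].
have muI I : is_arc I ->
    mu (carleson_square I) <= K%:E * (wmeas w (carleson_square I)) `^ (q / p).
  move=> aI; rewrite -carleson_ratio//; apply: le_trans muK.
  by apply: ereal_sup_ubound; exists I.
pose h (z : C) : R := (cmod (phi z) `^ alpha^-1)%R.
have h0 z : (0 <= h z)%R by exact: powR_ge0.
have mh : measurable_fun disc (h : C -> measurableTypeR R).
  apply: (measurableT_comp (measurable_powR _)).
  exact: (measurableT_comp measurable_cmod).
have hE z : (h z `^ (p * alpha) = cmod (phi z) `^ p)%R.
  by rewrite /h -powRrM mulrCA mulVf ?mulr1// gt_eqF.
set N := \int[areaA]_(z in disc) (cmod (phi z) `^ p * w z)%:E.
have EN : \int[areaA]_(z in disc) (h z `^ (p * alpha) * w z)%:E = N.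
  by apply: eq_integral => z _; rewrite hE.
have N0 : 0 <= N.
  by apply: integral_ge0 => z zd; rewrite lee_fin mulr_ge0 ?powR_ge0 ?w_ge0.
have Nfin : N < +oo.
  rewrite ltey; apply/eqP => E; move: Lphi; rewrite /Lpw_norm -/N E poweRyr ?ltxx//.
  by rewrite invr_eq0 gt_eqF.
have := maximal_strong_type w ww rw D D0 wD mu (q / p) K e1 K0 muI h h0 mh (p * alpha) pa.
rewrite EN => /(_ Nfin) H.
have fN : N \is a fin_num by rewrite ge0_fin_numE.
have SC0 : (0 <= SC * K)%R.
  apply: mulr_ge0 => //; rewrite /strong_constant !mulr_ge0 ?powR_ge0//.
  by apply: geometric_constant_ge0; rewrite subr_gt0.
rewrite /Lq_norm /Lpw_norm -/N.
apply: (@le_trans _ _ (((SC * K)%:E * N `^ (q / p)) `^ q^-1)).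
  apply: le_poweR; first by rewrite invr_ge0 ltW.
    by apply: integral_ge0 => z _; exact: poweR_ge0.
  rewrite -{1}(fineK fN) poweR_EFin -EFinM; apply: le_trans H.
  rewrite le_eqVlt; apply/orP; left; apply/eqP; apply: eq_integral => z _.
  rewrite /maximal_power gee0_abs ?poweR_ge0// -poweRrM; congr (_ `^ _).
  by field; rewrite gt_eqF.
rewrite poweRM ?poweR_ge0 ?lee_fin// poweR_EFin -poweRrM.
rewrite (_ : q / p * q^-1 = p^-1)%R//.
by field; rewrite !gt_eqF.
Qed.

End operator_bounds.

Lemma class_doubling (R : realType) (w : cplane R -> R) :
  class_I w \/ class_R w ->
  exists2 D : R, 0 < D &
  forall (I : interval R) (a L : R), is_arc I ->
  arc_length I <= L <= 2 * arc_length I ->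
  (wmeas w (half_open_square a L) <= D%:E * wmeas w (carleson_square I))%E.
Proof.
move=> hw.
have [ww rw] : weight w /\ radial w by case: hw => -[[]].
have [r0 [K [r01 K0 reg]]] : exists r0 K : R,
    [/\ 2^-1 <= r0 < 1, 0 < K & regular_near_1 w r0 K].
  by case: hw; [exact: class_I_regular|exact: class_R_regular].
have [B B0 HB] := tail_doubling w ww rw r0 K r01 K0 reg.
exists (16 * B); first by rewrite mulr_gt0.
move=> I a L aI lL.
exact: (carleson_doubling w ww rw B B0 HB).
Qed.

(* A Borel measure on the disc is given by a Borel measure on the plane, of
   which only the values on subsets of the disc are used. The constants c1, c2
   precede mu, as they may depend only on p, q, alpha and w. *)
Theorem corollary2p2 (R : realType) (p q alpha : R) (w : cplane R -> R)
    (hp : 0 < p) (hpq : p <= q) (halpha : 0 < alpha) (hpalpha : 1 < p * alpha)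
    (hw : class_I w \/ class_R w) :
  exists c1 c2 : R, 0 < c1 /\ 0 < c2 /\
  forall mu : {measure set (cplane R) -> \bar R},
    (bounded_op w p mu q (maximal_power w alpha) <->
       (carleson_sup w p q mu < +oo)%E) /\
    ((c1%:E * carleson_sup w p q mu
        <= (op_norm w p mu q (maximal_power w alpha)) `^ q)%E /\
     ((op_norm w p mu q (maximal_power w alpha)) `^ q
        <= c2%:E * carleson_sup w p q mu)%E).
Proof.
have [ww rw] : weight w /\ radial w by case: hw => -[[]].
have [D D0 wD] := class_doubling _ _ hw.
have q0 : 0 < q by exact: lt_le_trans hpq.
pose SC := strong_constant D (q / p) (p * alpha).
have SC0 : 0 < SC.
  rewrite /SC /strong_constant; apply: mulr_gt0.
    by apply: mulr_gt0 => //; apply: powR_gt0; move: D0; lra.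
  by rewrite invr_gt0 subr_gt0 invf_lt1 ?powR_gt0// powR2_gt1// subr_gt0.
exists 1, SC; do 2 (split => //); move=> mu.
have nec c := carleson_necessary w ww rw p q alpha hp hpq halpha mu c.
have sup0 := carleson_sup_ge0 w p q mu.
have suf K (K0 : 0 <= K) (muK : (carleson_sup w p q mu <= K%:E)%E) :=
  carleson_sufficient w ww rw p q alpha hp hpq halpha mu D K hpalpha D0 wD K0 muK.
have op0 : (0 <= op_norm w p mu q (maximal_power w alpha))%E.
  by apply: le_ereal_inf_tmp => _ [c [c0 _] <-]; rewrite lee_fin.
split; [split|split].
- by move=> [c /nec]; move/le_lt_trans; apply; rewrite ltry.
- move=> fin.
  have fS : carleson_sup w p q mu \is a fin_num by rewrite ge0_fin_numE.
  eexists; apply: (suf (fine (carleson_sup w p q mu))); first exact: fine_ge0.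
  by rewrite fineK.
- rewrite mul1e.
  have -> : carleson_sup w p q mu = ((carleson_sup w p q mu) `^ q^-1 `^ q)%E.
    by rewrite -poweRrM mulVf ?gt_eqF// poweRe1.
  apply: le_poweR; [exact: ltW|exact: poweR_ge0|].
  apply: le_ereal_inf_tmp => _ [c bc <-].
  have -> : c%:E = ((c `^ q)%:E `^ q^-1)%E.
    by rewrite poweR_EFin -powRrM divff ?gt_eqF// powRr1//; case: bc.
  by apply: le_poweR => //; [rewrite invr_ge0 ltW|exact: nec].
- have [fin|] := ltP (carleson_sup w p q mu) +oo%E; last first.
    by rewrite leye_eq => /eqP ->; rewrite gt0_muley ?lte_fin// leey.
  have fS : carleson_sup w p q mu \is a fin_num by rewrite ge0_fin_numE.
  set K := fine (carleson_sup w p q mu).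
  have K0 : 0 <= K by rewrite fine_ge0.
  have KE : carleson_sup w p q mu = K%:E by rewrite fineK.
  have SK : 0 <= SC * K by rewrite mulr_ge0// ltW.
  apply: (@le_trans _ _ ((((SC * K) `^ q^-1)%:E) `^ q)%E).
    apply: le_poweR => //; first exact: ltW.
    apply: ereal_inf_lbound; exists ((SC * K) `^ q^-1) => //.
    by apply: suf => //; rewrite KE.
  by rewrite poweR_EFin -powRrM mulVf ?gt_eqF// powRr1// KE EFinM.
Qed.
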